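(* Let $R$ be a commutative Noetherian semiperfect ring, let $C$ be a semidualizing $R$-module, and let $M$ be a horizontally linked (finite) $R$-module such that $\mathrm{Tor}^R_1(\mathrm{Tr}(M),C)=0$. Let $n$ and $t$ be two positive integers. Then the following statements are equivalent: (i) $M$ is reduced $\mathrm{G}_C$-perfect of $\mathrm{G}_C$-dimension $n$ and $\mathrm{Ext}_R^n(M,C)$ is $\mathrm{G}_C$-perfect of $\mathrm{G}_C$-dimension $n+t$; (ii) $\lambda M\otimes_R C$ is reduced $\mathrm{G}_C$-perfect of $\mathrm{G}_C$-dimension $t$ and $\mathrm{Ext}_R^t(\lambda M\otimes_R C,C)$ is $\mathrm{G}_C$-perfect of $\mathrm{G}_C$-dimension $n+t$.
   Context: A commutative Noetherian ring is semiperfect iff it is a finite direct product of local rings; over it every finite (= finitely generated) module has a projective cover. A finite $R$-module $C$ is semidualizing if the homothety map $R\to\mathrm{Hom}_R(C,C)$ is an isomorphism and $\mathrm{Ext}^i_R(C,C)=0$ for all $i>0$. Write $(-)^C=\mathrm{Hom}_R(-,C)$ and $(-)^*=\mathrm{Hom}_R(-,R)$. A finite module $X$ is totally $C$-reflexive if the biduality map $X\to X^{CC}$ is an isomorphism and $\mathrm{Ext}^i_R(X,C)=\mathrm{Ext}^i_R(X^C,C)=0$ for all $i>0$. For a finite module $M$, $\mathrm{G}_C\text{-}\dim_R(M)$ is the smallest $n\ge 0$ such that there is an exact sequence $0\to X_n\to\cdots\to X_0\to M\to 0$ with all $X_i$ totally $C$-reflexive, and $\infty$ if no such $n$ exists.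 $\mathrm{grade}_R(M)=\inf\{i\ge 0\mid \mathrm{Ext}^i_R(M,R)\ne 0\}$ and $\mathrm{r.grade}_R(M,C)=\inf\{i>0\mid \mathrm{Ext}^i_R(M,C)\ne 0\}$ (with $\inf\emptyset=\infty$). A finite module $M$ with finite $\mathrm{G}_C$-dimension is $\mathrm{G}_C$-perfect if $\mathrm{grade}_R(M)=\mathrm{G}_C\text{-}\dim_R(M)$, and reduced $\mathrm{G}_C$-perfect if $\mathrm{r.grade}_R(M,C)=\mathrm{G}_C\text{-}\dim_R(M)$. If $P_1\xrightarrow{f}P_0\to M\to 0$ is a minimal projective presentation, $\mathrm{Tr}(M)=\mathrm{Coker}(f^*\colon P_0^*\to P_1^* )$ (Auslander transpose). $\lambda M=\Omega\,\mathrm{Tr}(M)$ is the kernel of a projective cover of $\mathrm{Tr}(M)$. $M$ is horizontally linked if $M\cong\lambda(\lambda M)$. *)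

(* Defs.v *)
(** Modules over the commutative ring R are [lmodType R];
    submodules are packed predicates [submodClosed V]; ideals of R are
    submodules of the regular module [R^o], and proper ideals are [idealr R]. *)
From HB Require Import structures.
From mathcomp Require Import all_boot all_algebra.
From mathcomp Require Import boolp.
From mathcomp Require Import freeg.

Set Implicit Arguments.
Unset Strict Implicit.
Unset Printing Implicit Defensive.

Import GRing.Theory.
Import Quotient.
Local Open Scope ring_scope.
Local Open Scope quotient_scope.

Section Submodule.
Variables (R : comNzRingType) (V : lmodType R) (S : submodClosed V).

Record submod := Submod { submod_val : V; _ : submod_val \in S }.

HB.instance Definition _ := [isSub for submod_val].
HB.instance Definition _ := [Choice of submod by <:].
HB.instance Definition _ := [SubChoice_isSubLmodule of submod by <:].

(* [submodClosed] does not inherit from [zmodClosed], which the library's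
   quotient {quot _} requires. *)
Definition zmod_pred : {pred V} := fun x => x \in S.

Lemma zmod_pred_closed : zmod_closed zmod_pred.
Proof.
split=> [|x y]; first exact: (rpred0 S).
move=> Sx Sy; change (x - y \in S); rewrite -scaleN1r.
by apply: rpredD; [exact: Sx | apply: rpredZ; exact: Sy].
Qed.
HB.instance Definition _ := GRing.isZmodClosed.Build V zmod_pred zmod_pred_closed.

Definition quomod : Type := {quot (zmod_pred : zmodClosed V)}.
HB.instance Definition _ := GRing.Zmodule.on quomod.
HB.instance Definition _ := EqQuotient.on quomod.
Definition quo_pi (x : V) : quomod := \pi_quomod x.

Lemma quo_piP x y : quo_pi x = quo_pi y <-> x - y \in S.
Proof.
have E : (x - y \in S) = (quo_pi x == quo_pi y).
  exact: (@idealrBE V zmod_pred).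
by rewrite E; split=> [/eqP|/eqP].
Qed.

Lemma quo_piD : {morph quo_pi : x y / x + y}.
Proof. by move=> x y; exact: (raddfD (\pi_quomod)). Qed.

Lemma quo_reprK (x : quomod) : quo_pi (repr x) = x.
Proof. exact: reprK. Qed.

Definition quo_scale (a : R) (x : quomod) : quomod :=
  quo_pi (a *: repr x).

Lemma quo_scaleE a x : quo_scale a (quo_pi x) = quo_pi (a *: x).
Proof.
apply/quo_piP; rewrite -scalerBr; apply: rpredZ.
by apply/quo_piP; rewrite quo_reprK.
Qed.

Let quo_scaleA a b x : quo_scale a (quo_scale b x) = quo_scale (a * b) x.
Proof. by rewrite -[x]quo_reprK !quo_scaleE scalerA. Qed.
Let quo_scale1 x : quo_scale 1 x = x.
Proof. by rewrite -[x]quo_reprK !quo_scaleE scale1r. Qed.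
Let quo_scaleDr a x y : quo_scale a (x + y) = quo_scale a x + quo_scale a y.
Proof.
by rewrite -[x]quo_reprK -[y]quo_reprK -quo_piD !quo_scaleE scalerDr quo_piD.
Qed.
Let quo_scaleDl x a b : quo_scale (a + b) x = quo_scale a x + quo_scale b x.
Proof. by rewrite -[x]quo_reprK !quo_scaleE scalerDl quo_piD. Qed.

HB.instance Definition _ := GRing.Zmodule_isLmodule.Build R quomod
  quo_scaleA quo_scale1 quo_scaleDr quo_scaleDl.

Lemma quo_pi_linear : linear quo_pi.
Proof. by move=> a x y; rewrite quo_piD -quo_scaleE. Qed.
HB.instance Definition _ :=
  GRing.isLinear.Build R V quomod *:%R quo_pi quo_pi_linear.

End Submodule.

Section LinearMaps.
Variable R : comNzRingType.
Implicit Types U V W : lmodType R.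

Definition kernel U V (f : {linear U -> V}) : {pred U} := fun x => f x == 0.

Lemma kernel_closed U V (f : {linear U -> V}) : submod_closed (kernel f).
Proof.
split=> [|a x y]; rewrite !unfold_in /kernel ?linear0 //.
by rewrite linearP => /eqP-> /eqP->; rewrite scaler0 addr0.
Qed.
HB.instance Definition _ U V (f : {linear U -> V}) :=
  GRing.isSubmodClosed.Build R U (kernel f) (kernel_closed f).

Definition image U V (f : {linear U -> V}) : {pred V} :=
  fun y => `[< exists x, f x = y >].

Lemma image_closed U V (f : {linear U -> V}) : submod_closed (image f).
Proof.
split=> [|a x y]; rewrite !unfold_in.
  by apply/asboolP; exists 0; rewrite linear0.
move=> /asboolP[u <-] /asboolP[v <-]; apply/asboolP.
by exists (a *: u + v); rewrite linearP.
Qed.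
HB.instance Definition _ U V (f : {linear U -> V}) :=
  GRing.isSubmodClosed.Build R V (image f) (image_closed f).

Definition span V (G : V -> Prop) : {pred V} :=
  fun x => `[< forall S : submodClosed V, (forall y, G y -> y \in S) -> x \in S >].

Lemma span_closed V (G : V -> Prop) : submod_closed (span G).
Proof.
split=> [|a x y]; rewrite !unfold_in.
  by apply/asboolP => S _; exact: rpred0.
move=> /asboolP Gx /asboolP Gy; apply/asboolP => S GS.
by apply: rpredD; [apply: rpredZ; exact: Gx | exact: Gy].
Qed.
HB.instance Definition _ V (G : V -> Prop) :=
  GRing.isSubmodClosed.Build R V (span G) (span_closed G).

Definition coker U V (f : {linear U -> V}) : lmodType R := quomod (image f).

(* Homology at V of U -f-> V -g-> W, i.e. ker g modulo those of its elements
   that lie in im f. *)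
Definition boundary U V W (f : {linear U -> V}) (g : {linear V -> W}) :
  {pred submod (kernel g)} := fun x => val x \in image f.

Lemma boundary_closed U V W (f : {linear U -> V}) (g : {linear V -> W}) :
  submod_closed (boundary f (g := g)).
Proof.
split=> [|a x y fx fy]; first exact: (rpred0 (image f)).
change (val (a *: x + y) \in image f); rewrite linearP.
by apply: rpredD; [apply: rpredZ; exact: fx | exact: fy].
Qed.
HB.instance Definition _ U V W (f : {linear U -> V}) (g : {linear V -> W}) :=
  GRing.isSubmodClosed.Build R (submod (kernel g)) (boundary f (g := g))
    (boundary_closed f g).

Definition homology U V W (f : {linear U -> V}) (g : {linear V -> W}) :
  lmodType R := quomod (boundary f (g := g)).

Definition surjective U V (f : {linear U -> V}) := forall y, exists x, f x = y.

Definition exact_at U V W (f : {linear U -> V}) (g : {linear V -> W}) :=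
  forall y, g y = 0 <-> exists x, f x = y.

Definition isomorphic U V := exists f : {linear U -> V}, bijective f.

Definition is_zero V := forall x : V, x = 0.

Definition fin_gen V :=
  exists (n : nat) (g : 'I_n -> V), forall x, exists a : 'I_n -> R,
    x = \sum_(i < n) a i *: g i.

End LinearMaps.

Section HomModule.
Variables (R : comNzRingType) (U V : lmodType R).
Implicit Types f g h : {linear U -> V}.

HB.instance Definition _ := gen_eqMixin {linear U -> V}.
HB.instance Definition _ := gen_choiceMixin {linear U -> V}.

Lemma linear_ext f g : f =1 g -> f = g.
Proof.
case: f => f [[fD] [fZ]]; case: g => g [[gD] [gZ]] /= /funext /= fg.
subst g; rewrite (Prop_irrelevance fD gD) (Prop_irrelevance fZ gZ).
by [].
Qed.

Definition hom_zero : {linear U -> V} := @GRing.null_fun U V.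
Definition hom_add f g : {linear U -> V} := f \+ g.
Definition hom_opp f : {linear U -> V} := \- f.
Definition hom_scale (a : R) f : {linear U -> V} := a \*: f.

Let addA : associative hom_add.
Proof. by move=> f g h; apply: linear_ext => x /=; rewrite addrA. Qed.
Let addC : commutative hom_add.
Proof. by move=> f g; apply: linear_ext => x /=; rewrite addrC. Qed.
Let add0 : left_id hom_zero hom_add.
Proof. by move=> f; apply: linear_ext => x /=; rewrite add0r. Qed.
Let addN : left_inverse hom_zero hom_opp hom_add.
Proof. by move=> f; apply: linear_ext => x /=; rewrite addNr. Qed.
HB.instance Definition _ := GRing.isZmodule.Build {linear U -> V}
  addA addC add0 addN.

Let scaleA a b f : hom_scale a (hom_scale b f) = hom_scale (a * b) f.
Proof. by apply: linear_ext => x /=; rewrite scalerA. Qed.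
Let scale1 f : hom_scale 1 f = f.
Proof. by apply: linear_ext => x /=; rewrite scale1r. Qed.
Let scaleDr a f g : hom_scale a (f + g) = hom_scale a f + hom_scale a g.
Proof. by apply: linear_ext => x /=; rewrite scalerDr. Qed.
Let scaleDl f a b : hom_scale (a + b) f = hom_scale a f + hom_scale b f.
Proof. by apply: linear_ext => x /=; rewrite scalerDl. Qed.
HB.instance Definition _ := GRing.Zmodule_isLmodule.Build R {linear U -> V}
  scaleA scale1 scaleDr scaleDl.

End HomModule.

Section HomFunctor.
Variable R : comNzRingType.
Implicit Types U V W N : lmodType R.

Definition precomp_fun U V N (f : {linear U -> V}) (g : {linear V -> N}) :
  {linear U -> N} := g \o f.

Lemma precomp_linear U V N (f : {linear U -> V}) :
  linear (precomp_fun (N := N) f).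
Proof. by move=> a g h; apply: linear_ext. Qed.
HB.instance Definition _ U V N (f : {linear U -> V}) :=
  GRing.isLinear.Build R {linear V -> N} {linear U -> N} *:%R
    (precomp_fun (N := N) f) (@precomp_linear U V N f).

Definition precomp U V (f : {linear U -> V}) N :
  {linear {linear V -> N} -> {linear U -> N}} := precomp_fun (N := N) f.

Definition homothety (C : lmodType R) (r : R^o) : {linear C -> C} :=
  r \*: @idfun C.

Definition eval_at U N (x : U) (phi : {linear U -> N}) : N := phi x.

Lemma eval_at_linear U N (x : U) : linear (eval_at (N := N) x).
Proof. by []. Qed.
HB.instance Definition _ U N (x : U) :=
  GRing.isLinear.Build R {linear U -> N} N *:%R (eval_at (N := N) x)
    (@eval_at_linear U N x).

Definition biduality U N (x : U) : {linear {linear U -> N} -> N} :=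
  eval_at (N := N) x.

End HomFunctor.

(* Ext and Tor are computed from the functorial free resolution of M: P_0 is
   free on the underlying set of M, and P_(i+1) is free on the underlying set
   of the kernel of P_i -> P_(i-1) (with P_(-1) = M). *)

Section FreeResolution.
Variable R : comNzRingType.
Implicit Types M N : lmodType R.

HB.instance Definition _ (K : choiceType) M (f : K -> M) :=
  GRing.isZmodMorphism.Build {freeg K / R} M (fglift f) (lift_is_additive f).

Lemma fglift_scalable (K : choiceType) M (f : K -> M) :
  scalable (fglift f : {freeg K / R} -> M).
Proof.
move=> a D; rewrite -[in RHS](freeg_sumE D) [a *: D](_ : _ = fgscale a D) //.
rewrite /fgscale !raddf_sum /=.
by apply: eq_bigr => x _; rewrite !liftU scalerA.
Qed.
HB.instance Definition _ (K : choiceType) M (f : K -> M) :=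
  GRing.isScalable.Build R {freeg K / R} M *:%R (fglift f) (fglift_scalable f).

Definition free_on M : lmodType R := {freeg M / R}.

Definition augmentation M : {linear free_on M -> M} := fglift (@idfun M).

Fixpoint syzygy M (i : nat) : lmodType R :=
  if i is j.+1 then submod (kernel (augmentation (syzygy M j))) else M.

Definition free_res M (i : nat) : lmodType R := free_on (syzygy M i).

Definition free_diff M (i : nat) : {linear free_res M i.+1 -> free_res M i} :=
  (val : syzygy M i.+1 -> free_res M i) \o augmentation (syzygy M i.+1).

Definition Ext (i : nat) M N : lmodType R :=
  if i is j.+1
  then homology (precomp (free_diff M j) N) (precomp (free_diff M j.+1) N)
  else submod (kernel (precomp (free_diff M 0) N)).

End FreeResolution.

Section Tensor.
Variable R : comNzRingType.
Implicit Types M N : lmodType R.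

Local Notation gen m n := (<< (m, n) >> : {freeg (_ * _) / R}).

Inductive bilinear_relation M N : {freeg (M * N) / R} -> Prop :=
| TensorDl m m' n : bilinear_relation (gen (m + m') n - gen m n - gen m' n)
| TensorDr m n n' : bilinear_relation (gen m (n + n') - gen m n - gen m n')
| TensorZl a m n : bilinear_relation (gen (a *: m) n - a *: gen m n)
| TensorZr a m n : bilinear_relation (gen m (a *: n) - a *: gen m n).

Definition tensor M N : lmodType R := quomod (span (@bilinear_relation M N)).

Definition tensor_free M M' N (f : {linear M -> M'}) :
  {linear {freeg (M * N) / R} -> {freeg (M' * N) / R}} :=
  fglift (fun p : M * N => gen (f p.1) p.2).

Definition tensor_map_fun M M' N (f : {linear M -> M'}) (x : tensor M N) :
  tensor M' N := quo_pi _ (tensor_free N f (repr x)).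

Lemma tensor_freeP M M' N (f : {linear M -> M'}) x :
  x \in span (@bilinear_relation M N) ->
  tensor_free N f x \in span (@bilinear_relation M' N).
Proof.
pose q : {linear _ -> _} := quo_pi (span (@bilinear_relation M' N)).
have Eq y : (q y == 0) = (y \in span (@bilinear_relation M' N)).
  by rewrite -{2}[y]subr0; apply/eqP/idP => [h|/quo_piP h];
     [apply/quo_piP; rewrite -/q linear0 | rewrite linear0 in h].
pose g : {linear _ -> _} := q \o tensor_free N f.
move=> /asboolP /(_ (kernel g)) H; rewrite -Eq; apply: H => y Gy.
rewrite unfold_in /kernel /= Eq; apply/asboolP => S; apply.
have U k : tensor_free N f << k >> = gen (f k.1) k.2.
  by rewrite /tensor_free /= liftU scale1r.
case: y / Gy => *; rewrite !(linearB, linearZ_LR) /= !U /= ?linearD ?[f (_ *: _)]linearZ_LR ?scalerN.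
- exact: TensorDl.
- exact: TensorDr.
- exact: TensorZl.
- exact: TensorZr.
Qed.

Lemma tensor_map_funE M M' N (f : {linear M -> M'}) x :
  tensor_map_fun f (quo_pi _ x : tensor M N) = quo_pi _ (tensor_free N f x).
Proof.
apply/quo_piP; rewrite -linearB; apply: tensor_freeP.
by apply/quo_piP; rewrite quo_reprK.
Qed.

Lemma tensor_map_linear M M' N (f : {linear M -> M'}) :
  linear (@tensor_map_fun M M' N f).
Proof.
move=> a x y; rewrite -[x]quo_reprK -[y]quo_reprK -linearP.
by rewrite !tensor_map_funE !linearP.
Qed.
HB.instance Definition _ M M' N (f : {linear M -> M'}) :=
  GRing.isLinear.Build R (tensor M N) (tensor M' N) *:%R
    (@tensor_map_fun M M' N f) (@tensor_map_linear M M' N f).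

Definition tensor_map M M' (f : {linear M -> M'}) N :
  {linear tensor M N -> tensor M' N} := @tensor_map_fun M M' N f.

Definition Tor (i : nat) M N : lmodType R :=
  if i is j.+1
  then homology (tensor_map (free_diff M j.+1) N) (tensor_map (free_diff M j) N)
  else coker (tensor_map (free_diff M 0) N).

End Tensor.

Definition noetherian (R : comNzRingType) :=
  forall I : submodClosed R^o, fin_gen (submod I).

Definition maximal_ideal (A : comNzRingType) (m : idealr A) :=
  forall J : idealr A, {subset m <= J} -> J =i m.

Definition local_ring (A : comNzRingType) :=
  exists m : idealr A, maximal_ideal m /\
    forall m' : idealr A, maximal_ideal m' -> m' =i m.

(* The ring morphisms [f i] are the components of an isomorphism from R to the
   product of the [L i]. *)
Definition semiperfect (R : comNzRingType) :=
  exists (k : nat) (L : 'I_k -> comNzRingType) (f : forall i, {rmorphism R -> L i}),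
    (forall i, local_ring (L i)) /\
    (forall y : (forall i, L i), exists! x : R, forall i, f i x = y i).

Section Linkage.
Variable R : comNzRingType.
Implicit Types M N P Q T L : lmodType R.

Definition projective P :=
  forall (A B : lmodType R) (g : {linear A -> B}) (h : {linear P -> B}),
    surjective g -> exists h' : {linear P -> A}, forall x, g (h' x) = h x.

Definition superfluous P (K : submodClosed P) :=
  forall H : submodClosed P,
    (forall x, exists k h, [/\ k \in K, h \in H & x = k + h]) ->
    forall x, x \in H.

Definition projective_cover P M (p : {linear P -> M}) :=
  [/\ projective P, surjective p & superfluous (kernel p)].

Definition minimal_presentation P1 P0 M
    (f : {linear P1 -> P0}) (p : {linear P0 -> M}) :=
  projective_cover p /\
  exists2 q : {linear P1 -> submod (kernel p)},
    projective_cover q & forall x, val (q x) = f x.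

(* Tr M and lambda M are only determined up to isomorphism, whence relations. *)
Definition is_transpose M T :=
  exists (P1 P0 : lmodType R) (f : {linear P1 -> P0}) (p : {linear P0 -> M}),
    minimal_presentation f p /\ isomorphic T (coker (precomp f R^o)).

Definition is_lambda M L :=
  exists T, is_transpose M T /\
    exists Q (q : {linear Q -> T}),
      projective_cover q /\ isomorphic L (submod (kernel q)).

Definition horizontally_linked M :=
  exists L N, [/\ is_lambda M L, is_lambda L N & isomorphic M N].

End Linkage.

(* Infimum in {0, 1, 2, ..., oo}, where [None] is oo. *)
Definition inf_nat (P : nat -> Prop) : option nat :=
  match pselect (exists i, `[< P i >]) with
  | left exP => Some (ex_minn exP)
  | right _ => None
  end.

Section GDimension.
Variables (R : comNzRingType) (C : lmodType R).
Implicit Types M X : lmodType R.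

Definition semidualizing :=
  [/\ fin_gen C, bijective (@homothety R C)
    & forall i, (0 < i)%N -> is_zero (Ext i C C)].

Definition totally_reflexive X :=
  [/\ fin_gen X, bijective (@biduality R X C),
      forall i, (0 < i)%N -> is_zero (Ext i X C)
    & forall i, (0 < i)%N -> is_zero (Ext i {linear X -> C} C)].

(* Exact sequences 0 -> X_n -> ... -> X_0 -> M -> 0, continued by X_i = 0 for
   i > n. *)
Definition has_G_resolution M (n : nat) :=
  exists (X : nat -> lmodType R) (d : forall i, {linear X i.+1 -> X i})
         (e : {linear X 0 -> M}),
    [/\ surjective e, exact_at (d 0) e, forall i, exact_at (d i.+1) (d i),
        forall i, (i <= n)%N -> totally_reflexive (X i)
      & forall i, (n < i)%N -> is_zero (X i)].

Definition G_dim M : option nat := inf_nat (has_G_resolution M).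

Definition grade M : option nat := inf_nat (fun i => ~ is_zero (Ext i M R^o)).

Definition rgrade M : option nat :=
  inf_nat (fun i => (0 < i)%N /\ ~ is_zero (Ext i M C)).

Definition G_perfect M :=
  [/\ fin_gen M, G_dim M <> None & grade M = G_dim M].

Definition reduced_G_perfect M :=
  [/\ fin_gen M, G_dim M <> None & rgrade M = G_dim M].

End GDimension.

(* Main.v *)
(* Fix C semidualizing and let A be reduced G_C-perfect of G_C-dimension n, with
   a surjection V -> A from a totally C-reflexive module; let B be the cokernel
   of the dual map A^C -> V^C and E = Ext^n(A, C).  Dualizing a resolution of A
   by totally C-reflexive modules exhibits B as an n-th syzygy of E with respect
   to totally C-reflexive modules.  Hence, if E is G_C-perfect of dimension
   n + t, then B has G_C-dimension t and Ext^i(B, C) = Ext^(i + n)(E, C) for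
   i > 0, so B is reduced G_C-perfect; and the same duality applied to E itself
   shows that Ext^(n + t)(E, C) is again G_C-perfect of dimension n + t.

   This statement is symmetric in A and B, so the theorem follows once M and
   lambda M (x) C are such a pair: for a minimal presentation
   P1 -> P0 -> M, the vanishing of Tor_1(Tr M, C) identifies lambda M (x) C with
   the cokernel of M^C -> P0^C, and conversely M is the cokernel of
   (lambda M (x) C)^C -> P0^CC = P0 because M embeds in a projective module and
   is therefore C-torsionless.

   Grades with respect to R and to C agree: writing R = Hom(C, C), the first
   nonzero Ext^i(E, C) satisfies Ext^i(E, R) = Hom(C, Ext^i(E, C)), which is
   nonzero since C is finite and faithful. *)
Require Import Defs.
From HB Require Import structures.
From mathcomp Require Import all_boot all_algebra.
From mathcomp Require Import boolp freeg.

Set Implicit Arguments.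
Unset Strict Implicit.
Unset Printing Implicit Defensive.

Import GRing.Theory.
Local Open Scope ring_scope.

(** Ext is computed here from free modules on underlying sets, which are in general far from
    finitely generated, whereas the argument works with finite modules. Vanishing of Ext is
    therefore expressed by an extension property that mentions no resolution. Only its
    half-exactness in the middle term is proved directly; the other parts of the long exact sequence
    follow by rotating short exact sequences, because syzygies are unique up to projective summands.
    Nonvanishing in the top degree is obtained indirectly: a module of finite G_C-dimension with Hom
    and all Ext into C equal to zero is itself zero.

    Two steps need more than homological algebra. That Hom(C, Y) is nonzero for every nonzero Y,
    finite or not, comes from a prime annihilator in Y and Nakayama's lemma at that prime, with
    denominators cleared instead of localising. And placing lambda M inside the dual of P1 requires
    the map from that dual to Tr M to be a projective cover. *)

(** * Building linear maps from relations *)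

Section LinearChoice.
Variables (R : comNzRingType).
Implicit Types U V W : lmodType R.

Definition mk_linear U V (f : U -> V) (lin_f : linear f) : {linear U -> V} :=
  HB.pack f (GRing.isLinear.Build R U V *:%R f lin_f).

(** A total linear relation with only 0 above 0 is the graph of a linear map. Maps defined by
    choosing preimages in a diagram are built this way, so that linearity is checked on the relation
    and not on the choices. *)
Lemma linear_choice U V (r : U -> V -> Prop) :
    (forall x, exists y, r x y) ->
    (forall a x y x' y', r x x' -> r y y' -> r (a *: x + y) (a *: x' + y')) ->
    (forall y, r 0 y -> y = 0) ->
  exists f : {linear U -> V}, forall x, r x (f x).
Proof.
move=> /choice[f rf] rD r0.
have r_fun x y y' : r x y -> r x y' -> y = y'.
  move=> rxy rxy'; apply/eqP; rewrite eq_sym -subr_eq0 addrC -scaleN1r; apply/eqP/r0.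
  by rewrite -(addNr x) -scaleN1r; exact: rD.
have lin_f : linear f by move=> a x y; apply: (r_fun (a *: x + y)) => //; exact: rD.
by exists (mk_linear lin_f).
Qed.

Lemma linear_inverse U V (f : {linear U -> V}) :
  injective f -> surjective f ->
  exists2 g : {linear V -> U}, cancel f g & cancel g f.
Proof.
move=> f_inj f_surj.
have [||y|g gP] := @linear_choice V U (fun y x => f x = y).
- exact: f_surj.
- by move=> a x y x' y' <- <-; rewrite linearP.
- by move=> y0; apply: f_inj; rewrite linear0.
by exists g => [x|x]; [apply: f_inj|]; exact: gP.
Qed.

Lemma pair_linear U V W (f : {linear W -> U}) (g : {linear W -> V}) :
  exists h : {linear W -> (U * V)%type}, forall w, h w = (f w, g w).
Proof.
have lin : linear (fun w => (f w, g w) : (U * V)%type).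
  by move=> a x y; rewrite !linearP.
by exists (mk_linear lin).
Qed.

Lemma copair_linear U V W (f : {linear U -> W}) (g : {linear V -> W}) :
  exists h : {linear (U * V)%type -> W}, forall u v, h (u, v) = f u + g v.
Proof.
have lin : linear (fun w : (U * V)%type => f w.1 + g w.2).
  move=> a x y /=; rewrite !linearP /= scalerDr -!addrA; congr (_ + _).
  by rewrite addrCA.
by exists (mk_linear lin).
Qed.

Lemma isomorphic_refl U : isomorphic U U.
Proof. by exists idfun; exists id. Qed.

Lemma bij_inj_surj U V (f : {linear U -> V}) :
  bijective f <-> injective f /\ surjective f.
Proof.
split=> [f_bij|[fi fs]].
  split; first exact: bij_inj.
  by case: f_bij => g fK gK y; exists (g y).
by have [g fK gK] := linear_inverse fi fs; exists g.
Qed.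

Lemma isomorphic_sym U V : isomorphic U V -> isomorphic V U.
Proof.
move=> [f /bij_inj_surj[fi fs]]; have [g fK gK] := linear_inverse fi fs.
by exists g; exists f.
Qed.

Lemma isomorphic_trans U V W : isomorphic U V -> isomorphic V W -> isomorphic U W.
Proof.
by move=> [f f_bij] [g g_bij]; exists (g \o f); exact: bij_comp.
Qed.

Lemma linear_inj0 U V (f : {linear U -> V}) :
  (forall x, f x = 0 -> x = 0) -> injective f.
Proof.
move=> f0 x y fxy; apply/eqP; rewrite -subr_eq0; apply/eqP/f0.
by rewrite linearB fxy subrr.
Qed.

End LinearChoice.

(** * Short exact sequences, pullbacks and free modules *)

Section Exact.
Variables (R : comNzRingType).
Implicit Types A B K U V W X Z P N : lmodType R.

Definition ses K V A (i : {linear K -> V}) (e : {linear V -> A}) :=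
  [/\ injective i, surjective e & exact_at i e].

Lemma ses_comp0 K V A (i : {linear K -> V}) (e : {linear V -> A}) :
  ses i e -> forall k, e (i k) = 0.
Proof. by case=> _ _ ex k; apply/ex; exists k. Qed.

Lemma kernelE U V (f : {linear U -> V}) x : (x \in kernel f) = (f x == 0).
Proof. by []. Qed.

Lemma submod_kernelP U V (f : {linear U -> V}) (x : submod (kernel f)) :
  f (val x) = 0.
Proof. by apply/eqP; rewrite -kernelE; exact: valP. Qed.

Definition ker_incl U V (f : {linear U -> V}) : {linear submod (kernel f) -> U} :=
  val.

Lemma ses_kernel V A (e : {linear V -> A}) :
  surjective e -> ses (ker_incl e) e.
Proof.
move=> e_surj; split=> //; first exact: val_inj.
move=> y; split=> [/eqP ey0|[x <-]]; last exact: submod_kernelP.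
by exists (Submod (ey0 : y \in kernel e)).
Qed.

Lemma ses_lift X K V A (i : {linear K -> V}) (e : {linear V -> A})
    (g : {linear X -> V}) :
  ses i e -> (forall x, e (g x) = 0) ->
  exists g' : {linear X -> K}, forall x, i (g' x) = g x.
Proof.
move=> [ii _ ex] eg0.
have [||y|g' gP] := @linear_choice _ X K (fun x k => i k = g x).
- by move=> x; apply/ex.
- by move=> a x y x' y' ix iy; rewrite !linearP ix iy.
- by rewrite linear0 => iy0; apply: ii; rewrite linear0.
by exists g'.
Qed.

Lemma ses_factor X V A K (i : {linear K -> V}) (e : {linear V -> A})
    (g : {linear V -> X}) :
  ses i e -> (forall k, g (i k) = 0) ->
  exists g' : {linear A -> X}, forall v, g' (e v) = g v.
Proof.
move=> [_ es ex] gi0.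
have [||y|g' gP] := @linear_choice _ A X (fun a x => exists2 v, e v = a & g v = x).
- by move=> a; have [v <-] := es a; exists (g v), v.
- move=> a _ _ _ _ [v <- <-] [w <- <-]; exists (a *: v + w); by rewrite linearP.
- by move=> [v /ex[k <-] <-].
exists g' => v; have [w ewv gw] := gP (e v).
rewrite -gw; apply/eqP; rewrite -subr_eq0 -linearB; apply/eqP.
have [|k <-] := (ex (w - v)).1; last exact: gi0.
by rewrite linearB ewv subrr.
Qed.

(** The pullback is the kernel of (z, v) |-> e z - f v on Z x V. The last two clauses, joint
    injectivity of the projections and existence of common lifts, are its universal property in the
    form diagram chases use. *)
Lemma ses_pullback K Z A V (i : {linear K -> Z}) (e : {linear Z -> A})
    (f : {linear V -> A}) :
  ses i e ->
  exists (W : lmodType R) (j : {linear K -> W}) (p : {linear W -> Z})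
      (q : {linear W -> V}),
    [/\ ses j q, forall w, e (p w) = f (q w), forall k, p (j k) = i k,
        forall w w', p w = p w' -> q w = q w' -> w = w'
      & forall z v, e z = f v -> exists w, p w = z /\ q w = v].
Proof.
move=> sie; have [ii es ex] := sie.
have lin : linear (fun w : (Z * V)%type => e w.1 - f w.2).
  move=> a x y /=; rewrite [e _]linearP [f _]linearP scalerBr opprD.
  by rewrite addrACA.
pose d := mk_linear lin.
have lin_p : linear (fun w : submod (kernel d) => (val w).1).
  by move=> a x y; rewrite linearP.
have lin_q : linear (fun w : submod (kernel d) => (val w).2).
  by move=> a x y; rewrite linearP.
have lin_j0 : linear (fun k : K => (i k, 0) : (Z * V)%type).
  by move=> a x y; rewrite linearP; congr pair => /=; rewrite scaler0 addr0.
have mem_d z v : e z = f v -> (z, v) \in kernel d.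
  by move=> ezv; rewrite kernelE /= ezv subrr.
have lin_j : linear (fun k : K => Submod (mem_d (i k) 0
    (etrans (ses_comp0 sie k) (esym (linear0 f))))).
  by move=> a x y; apply: val_inj; exact: lin_j0.
exists (submod (kernel d)), (mk_linear lin_j), (mk_linear lin_p), (mk_linear lin_q).
split.
- split=> [k k' /(congr1 val) /= [/ii]//|v|w].
    have [z ez] := es (f v).
    by exists (Submod (mem_d z v ez)).
  split=> [/= w20|[k <-]//].
  have : e (val w).1 = 0.
    have /= /eqP := submod_kernelP w; rewrite subr_eq0 => /eqP ->.
    by rewrite w20 linear0.
  move=> /ex[k ik]; exists k; apply: val_inj => /=.
  by case: w w20 ik => [[z v] ?] /= -> ->.
- by move=> w; have /= /eqP := submod_kernelP w; rewrite subr_eq0 => /eqP.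
- by [].
- by move=> [[z v] ?] [[z' v'] ?] /= pw qw; apply: val_inj; rewrite /= pw qw.
- by move=> z v ezv; exists (Submod (mem_d z v ezv)).
Qed.

Lemma projective_lift P A B (g : {linear A -> B}) (h : {linear P -> B}) :
  projective P -> surjective g -> exists h' : {linear P -> A}, forall x, g (h' x) = h x.
Proof. by move=> projP /projP; apply. Qed.

Lemma linear_free_ext A B (f g : {linear free_on A -> B}) :
  (forall x, f << x >> = g << x >>) -> f =1 g.
Proof.
move=> fg D; rewrite -(freeg_sumE D) !linear_sum; apply: eq_bigr => x _.
have -> : << coeff x D *g x >> = coeff x D *: << x >> :> {freeg A / R}.
  by apply/eqP/freeg_eqP => y; rewrite coeffZ !coeffU mul1r.
by rewrite 2!linearZ fg.
Qed.

Lemma augmentationU A (x : A) : augmentation A << x >> = x.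
Proof. by rewrite /augmentation /= liftU scale1r. Qed.

Lemma augmentation_surj A : surjective (augmentation A).
Proof. by move=> x; exists << x >>; exact: augmentationU. Qed.

Lemma free_on_projective A : projective (free_on A).
Proof.
move=> X B g h g_surj.
have [s sP] := choice (fun x : A => g_surj (h << x >>)).
exists (fglift s : {linear {freeg A / R} -> X}) => x.
apply: (@linear_free_ext A B (g \o (fglift s : {linear {freeg A / R} -> X})) h) => y.
by rewrite /= liftU scale1r sP.
Qed.

End Exact.

(** * Vanishing of Ext without resolutions, and its exactness properties *)

Section ExtVanishing.
Variables (R : comNzRingType).
Implicit Types A B H K U V W X Z P N : lmodType R.

Definition extendable K V N (i : {linear K -> V}) (h : {linear K -> N}) :=
  exists h' : {linear V -> N}, forall k, h' (i k) = h k.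

(* Vanishing of [Ext 1 A N], expressed without a choice of resolution. *)
Definition ext1v N A :=
  forall K V (i : {linear K -> V}) (e : {linear V -> A}), ses i e ->
  forall h : {linear K -> N}, extendable i h.

(** Schanuel's square: the pullback of two presentations of A is an extension of either middle term
    by the kernel of the other. Two presentations are compared through it without any
    projectivity. *)
Lemma ses_pullback_sym K V A K' Z (i : {linear K -> V}) (e : {linear V -> A})
    (i' : {linear K' -> Z}) (e' : {linear Z -> A}) :
  ses i e -> ses i' e' ->
  exists (W : lmodType R) (j : {linear K' -> W}) (m : {linear K -> W})
      (p : {linear W -> Z}) (q : {linear W -> V}),
    [/\ ses j q, ses m p, forall k, p (j k) = i' k & forall k, q (m k) = i k].
Proof.
move=> sie sie'; have [ii es ex] := sie.
have [W [j [p [q [sjq epq pj pq_inj pq_ex]]]]] := ses_pullback e sie'.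
have [||w|m mP] := @linear_choice _ K W (fun k w => p w = 0 /\ q w = i k).
- by move=> k; apply: pq_ex; rewrite (ses_comp0 sie) linear0.
- move=> a x y x' y' [px qx] [py qy]; rewrite !linearP px py qx qy.
  by rewrite scaler0 addr0.
- by rewrite linear0 => -[pw qw]; apply: pq_inj; rewrite linear0.
exists W, j, m, p, q; split=> // [|k]; last by case: (mP k).
split=> [k k' mk|z|w].
- by apply: ii; rewrite -(mP k).2 -(mP k').2 mk.
- by have [v ev] := es (e' z); have [w [pw _]] := pq_ex z v (esym ev); exists w.
split=> [pw|[k <-]]; last by have [] := mP k.
have [|k ik] := (ex (q w)).1; first by rewrite -epq pw linear0.
by exists k; have [pk qk] := mP k; apply: pq_inj; rewrite ?pk ?qk.
Qed.

(** A single presentation with acyclic middle term decides vanishing. On the Schanuel pullback W,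
    the given map extends because Ext^1(V, N) = 0; its restriction to K extends to V, and the
    difference kills K and so descends to the middle term of the sequence under test. *)
Lemma ext1v_of_extendable K V A N (i : {linear K -> V}) (e : {linear V -> A}) :
  ses i e -> ext1v N V -> (forall h : {linear K -> N}, extendable i h) ->
  ext1v N A.
Proof.
move=> sie vV ext K' Z i' e' sie' h.
have [W [j [m [p [q [sjq smp pj qm]]]]]] := ses_pullback_sym sie sie'.
have [g gj] := vV _ _ _ _ sjq h.
have [g' g'P] := ext (g \o m : {linear K -> N}).
have [|h' h'P] := ses_factor (g := g \- (g' \o q) : {linear W -> N}) smp.
  by move=> k /=; rewrite qm g'P subrr.
exists h' => k; rewrite -pj h'P /= gj.
by rewrite (ses_comp0 sjq) linear0 subr0.
Qed.

Lemma ext1v_projective N P : projective P -> ext1v N P.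
Proof.
move=> projP K Z i e sie h; have [ii es _] := sie.
have [s sP] := projective_lift idfun projP es.
have [|d dP] := @ses_lift _ _ _ _ _ _ _ (idfun \- (s \o e) : {linear Z -> Z}) sie.
  by move=> x /=; rewrite linearB sP subrr.
exists (h \o d : {linear Z -> N}) => k /=; congr (h _); apply: ii.
by rewrite dP /= (ses_comp0 sie) linear0 subr0.
Qed.

(** For a sequence K' -> Z -> V, let W be the preimage of K in Z. A map on K' extends to W because W
    / K' = K, then to Z because Z / W = A. *)
Lemma ext1v_ses_mid K V A N (i : {linear K -> V}) (e : {linear V -> A}) :
  ses i e -> ext1v N K -> ext1v N A -> ext1v N V.
Proof.
move=> sie vK vA K' Z i' e' sie' h.
have [W [j [p [q [sjq epq pj pq_inj pq_ex]]]]] := ses_pullback i sie'.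
have [g gj] := vK _ _ _ _ sjq h.
have [ii es ex] := sie; have [_ es' _] := sie'.
have spe : ses p (e \o e').
  split=> [w w' pw|a|z /=].
  - by apply: pq_inj => //; apply: ii; rewrite -!epq pw.
  - by have [v <-] := es a; have [z <-] := es' v; exists z.
  - split=> [/ex[k ik]|[w <-]]; last by rewrite epq (ses_comp0 sie).
    by have [w [pw _]] := pq_ex z k (esym ik); exists w.
have [h' h'P] := vA _ _ _ _ spe g.
by exists h' => k; rewrite -pj h'P gj.
Qed.

Lemma ext1v_retract N X U (a : {linear X -> U}) (b : {linear U -> X}) :
  cancel a b -> ext1v N U -> ext1v N X.
Proof.
move=> ab vU K Z i e sie h.
have [W [j [p [q [sjq epq pj pq_inj pq_ex]]]]] := ses_pullback b sie.
have [g gj] := vU _ _ _ _ sjq h.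
have [||w|m mP] := @linear_choice _ Z W (fun z w => p w = z /\ q w = a (e z)).
- by move=> z; apply: pq_ex; rewrite ab.
- by move=> c x y x' y' [<- qx] [<- qy]; rewrite !linearP qx qy.
- by rewrite !linear0 => -[pw qw]; apply: pq_inj; rewrite linear0.
exists (g \o m : {linear Z -> N}) => k /=; rewrite -gj; congr (g _).
have [pm qm] := mP (i k); apply: pq_inj; first by rewrite pm pj.
by rewrite qm (ses_comp0 sjq) (ses_comp0 sie) linear0.
Qed.

Definition fst_lin U V : {linear (U * V)%type -> U} :=
  @mk_linear R (U * V)%type U fst (fun _ _ _ => erefl).
Definition snd_lin U V : {linear (U * V)%type -> V} :=
  @mk_linear R (U * V)%type V snd (fun _ _ _ => erefl).

Lemma ses_pair U V : exists (i : {linear U -> (U * V)%type}), ses i (snd_lin U V)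
  /\ forall u, i u = (u, 0).
Proof.
have [i iP] := pair_linear (@idfun U : {linear U -> U}) (\0 : {linear U -> V}).
exists i; split=> //; split=> [u u'|v|[u v]].
- by rewrite !iP => -[].
- by exists (0, v).
- split=> [/= ->|[u']]; first by exists u; rewrite iP.
  by rewrite iP => -[_ <-].
Qed.

Lemma ext1v_pair N U V : ext1v N U -> ext1v N V -> ext1v N (U * V)%type.
Proof. by have [i [si _]] := ses_pair U V; exact: ext1v_ses_mid si. Qed.

Lemma projective_pair P Q : projective P -> projective Q -> projective (P * Q)%type.
Proof.
move=> projP projQ A B g h g_surj.
have [i iP] := pair_linear (@idfun P : {linear P -> P}) (\0 : {linear P -> Q}).
have [j jP] := pair_linear (\0 : {linear Q -> P}) (@idfun Q : {linear Q -> Q}).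
have [f fP] := projective_lift (h \o i : {linear P -> B}) projP g_surj.
have [f' f'P] := projective_lift (h \o j : {linear Q -> B}) projQ g_surj.
have [k kP] := copair_linear f f'.
exists k => -[x y]; rewrite kP linearD fP f'P /= -linearD iP jP.
by congr (h _); congr pair; rewrite /= ?addr0 ?add0r.
Qed.

Definition Omega A : lmodType R := syzygy A 1.
Definition Omega_incl A : {linear Omega A -> free_on A} := ker_incl (augmentation A).

Lemma ses_Omega A : ses (Omega_incl A) (augmentation A).
Proof. exact/ses_kernel/augmentation_surj. Qed.

(** [syzygy] adds each new syzygy on the outside; dimension shifting needs the first one peeled off
    instead. *)
Lemma syzygyS A j : syzygy A j.+1 = syzygy (Omega A) j.
Proof. by elim: j => // j IHj; exact: (congr1 Omega IHj). Qed.

Lemma ses_map_projective K V A A1 P (i : {linear K -> V}) (e : {linear V -> A})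
    (j : {linear A1 -> P}) (p : {linear P -> A}) :
  ses i e -> ses j p -> projective P ->
  exists (al : {linear P -> V}) (al' : {linear A1 -> K}),
    (forall x, e (al x) = p x) /\ (forall w, i (al' w) = al (j w)).
Proof.
move=> sie sjp projP; have [_ es _] := sie.
have [al alP] := projective_lift p projP es.
have [|al' al'P] := ses_lift (g := al \o j : {linear A1 -> V}) sie.
  by move=> x /=; rewrite alP (ses_comp0 sjp).
by exists al, al'.
Qed.

(** A mapping cone: 0 -> K -> V -> A -> 0 turns into 0 -> A1 -> K x P -> V -> 0, where A1 is a
    syzygy of A. Rotation moves each term into the middle position, which takes the place of
    connecting homomorphisms. *)
Lemma ses_rotate K V A A1 P (i : {linear K -> V}) (e : {linear V -> A})
    (j : {linear A1 -> P}) (p : {linear P -> A})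
    (al : {linear P -> V}) (al' : {linear A1 -> K}) :
  ses i e -> ses j p ->
  (forall x, e (al x) = p x) -> (forall w, i (al' w) = al (j w)) ->
  exists (f : {linear A1 -> (K * P)%type}) (g : {linear (K * P)%type -> V}),
    [/\ ses f g, forall w, f w = (- al' w, j w) & forall k x, g (k, x) = i k + al x].
Proof.
move=> sie sjp alP al'P; have [ii es ex] := sie; have [ij ps exp] := sjp.
have [f fP] := pair_linear (\- al' : {linear A1 -> K}) j.
have [g gP] := copair_linear i al.
exists f, g; split=> //; split=> [w w'|v|[k x]].
- by rewrite !fP => -[_ /ij].
- have [x px] := ps (e v).
  have [|k ik] := (ex (v - al x)).1; first by rewrite linearB alP px subrr.
  by exists (k, x); rewrite gP ik subrK.
rewrite gP; split=> [gkx|[w]]; last first.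
  by rewrite fP => -[<- <-]; rewrite linearN al'P addNr.
have [|w jw] := (exp x).1.
  have := congr1 e gkx; rewrite linearD (ses_comp0 sie) add0r alP.
  by rewrite linear0.
exists w; rewrite fP jw; congr pair; apply: ii; apply/eqP.
by rewrite linearN al'P jw eq_sym -addr_eq0 gkx.
Qed.

Lemma horseshoe (K V A K1 PK A1 PA : lmodType R) (i : {linear K -> V}) (e : {linear V -> A})
    (i1 : {linear K1 -> PK}) (p1 : {linear PK -> K})
    (iA : {linear A1 -> PA}) (pA : {linear PA -> A}) :
  ses i e -> ses i1 p1 -> ses iA pA -> projective PA ->
  exists (H : lmodType R) (iH : {linear H -> (PK * PA)%type}) (g : {linear (PK * PA)%type -> V})
      (j : {linear K1 -> H}) (r : {linear H -> A1}),
    [/\ ses iH g, ses j r & forall k, iH (j k) = (i1 k, 0)].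
Proof.
move=> sie si1 siA projA.
have [al [al' [alP al'P]]] := ses_map_projective sie siA projA.
have [g gP] := copair_linear (i \o p1) al.
have [ii es ex] := sie; have [i1i p1s ex1] := si1; have [iAi pAs exA] := siA.
have g_surj : surjective g.
  move=> v; have [y py] := pAs (e v).
  have [|k ik] := (ex (v - al y)).1; first by rewrite linearB alP py subrr.
  by have [x px] := p1s k; exists (x, y); rewrite gP /= px ik subrK.
have sH := ses_kernel g_surj.
set H := submod (kernel g) in sH; set iH := ker_incl g in sH.
have [l lP] := pair_linear i1 (\0 : {linear K1 -> PA}).
have [|j jP] := ses_lift (g := l) sH.
  by move=> k; rewrite lP gP /= (ses_comp0 si1) !linear0 addr0.
have gH0 h : i (p1 (iH h).1) + al (iH h).2 = 0.
  by have := ses_comp0 sH h; case: (iH h) => x y; rewrite gP.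
have [|r rP] := ses_lift (g := snd_lin PK PA \o iH : {linear H -> PA}) siA.
  move=> h /=; rewrite -alP; have := congr1 e (gH0 h).
  by rewrite linearD (ses_comp0 sie) add0r linear0.
exists H, iH, g, j, r; split=> //; last by move=> k; rewrite jP lP.
split=> [k k' jk|a|h].
- by have := jP k; rewrite jk jP !lP => -[/i1i].
- have [|k ik] := (ex (al (iA a))).1; first by rewrite alP (ses_comp0 siA).
  have [x px] := p1s k.
  have [_ _ exH] := sH.
  have [|h hP] := (exH (- x, iA a)).1; first by rewrite gP /= !linearN px ik addNr.
  by exists h; apply: iAi; rewrite rP -[RHS]/(- x, iA a).2 -hP.
- split=> [rh|[k <-]]; last first.
    by apply: iAi; rewrite rP linear0 -[RHS]/(i1 k, 0).2 -lP -jP.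
  have h2 : (iH h).2 = 0 by have := rP h; rewrite rh linear0.
  have [|k ik] := (ex1 (iH h).1).1.
    by apply: ii; have := gH0 h; rewrite h2 !linear0 addr0.
  exists k; have [iHi _ _] := sH; apply: iHi; rewrite jP lP ik.
  by case: (iH h) h2 => x y /= ->.
Qed.

(** The identity of X factors through U x P, so X is a direct summand of U up to a projective
    module. Syzygies are determined only up to this relation, and vanishing of Ext passes along
    it. *)
Definition stable_summand X U :=
  exists P (a1 : {linear X -> U}) (a2 : {linear X -> P})
      (b1 : {linear U -> X}) (b2 : {linear P -> X}),
    projective P /\ forall x, x = b1 (a1 x) + b2 (a2 x).

Lemma stable_summand_syzygy (X U KX PX KU PU : lmodType R)
    (iX : {linear KX -> PX}) (pX : {linear PX -> X})
    (iU : {linear KU -> PU}) (pU : {linear PU -> U}) :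
  ses iX pX -> ses iU pU -> projective PX -> projective PU ->
  stable_summand X U -> stable_summand KX KU.
Proof.
move=> sX sU projX projU [P [a1 [a2 [b1 [b2 [projP idX]]]]]].
have [_ pXs _] := sX; have [_ pUs _] := sU.
have [A1 A1P] := projective_lift (a1 \o pX) projX pUs.
have [B1 B1P] := projective_lift (b1 \o pU) projU pXs.
have [B2 B2P] := projective_lift b2 projP pXs.
have [|a1' a1'P] := ses_lift (g := A1 \o iX : {linear KX -> PU}) sU.
  by move=> k /=; rewrite A1P /= (ses_comp0 sX) linear0.
have [|b1' b1'P] := ses_lift (g := B1 \o iU : {linear KU -> PX}) sX.
  by move=> k /=; rewrite B1P /= (ses_comp0 sU) linear0.
(* The error of the lifted decomposition: [pX] kills [E0], so it factors through [KX]. On [KX] the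
   last term vanishes, which leaves the identity of [KX] as b1' a1' plus a map factoring through the
   projective [PX]. *)
pose E0 : {linear PX -> PX} := (idfun \- (B1 \o A1)) \- (B2 \o (a2 \o pX)).
have [|E EP] := ses_lift (g := E0) sX.
  by move=> x; rewrite /= !linearB /= B1P /= A1P B2P /= -addrA -opprD -idX subrr.
exists PX, a1', iX, b1', E; split=> // k.
have [iXi _ _] := sX; apply: iXi.
rewrite linearD EP b1'P /E0 /= a1'P /= (ses_comp0 sX) !linear0 addr0.
by rewrite addrC subrK.
Qed.

Lemma stable_summand_refl X : stable_summand X X.
Proof.
exists (free_on X), idfun, \0, idfun, \0; split; first exact: free_on_projective.
by move=> x /=; rewrite addr0.
Qed.

Lemma stable_summand_syzygies X U j :
  stable_summand X U -> stable_summand (syzygy X j) (syzygy U j).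
Proof.
elim: j => //= j IHj /IHj; apply: stable_summand_syzygy; try exact: ses_Omega.
- exact: free_on_projective.
- exact: free_on_projective.
Qed.

Lemma stable_summand_ext1v N X U : stable_summand X U -> ext1v N U -> ext1v N X.
Proof.
move=> [P [a1 [a2 [b1 [b2 [projP idX]]]]]] vU.
have [a aP] := pair_linear a1 a2; have [b bP] := copair_linear b1 b2.
apply: (@ext1v_retract N X (U * P)%type a b).
  by move=> x; rewrite aP bP -idX.
by apply: ext1v_pair => //; exact: ext1v_projective.
Qed.

Lemma stable_summand_pairl U P : projective P -> stable_summand (U * P)%type U.
Proof.
move=> projP.
have [i [_ iP]] := ses_pair U P.
have [j jP] := pair_linear (\0 : {linear P -> U}) (@idfun P : {linear P -> P}).
exists P, (fst_lin U P), (snd_lin U P), i, j; split=> // -[u x].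
by rewrite iP jP /=; congr pair; rewrite /= ?addr0 ?add0r.
Qed.

Lemma stable_summand_fst U V : stable_summand U (U * V)%type.
Proof.
have [i [_ iP]] := ses_pair U V.
exists (free_on U), i, \0, (fst_lin U V), \0; split; first exact: free_on_projective.
by move=> x; rewrite iP /= addr0.
Qed.

Lemma stable_summand_iso U V : isomorphic U V -> stable_summand U V.
Proof.
move=> [f /bij_inj_surj[fi fs]]; have [g fK gK] := linear_inverse fi fs.
exists (free_on U), f, \0, g, \0; split; first exact: free_on_projective.
by move=> x; rewrite fK /= addr0.
Qed.

(* [extv N j A] is the vanishing of [Ext j.+1 A N]. *)
Definition extv N j A := ext1v N (syzygy A j).

Lemma extvS N j A : extv N j.+1 A = extv N j (Omega A).
Proof. by rewrite /extv syzygyS. Qed.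

Lemma extv_stable_summand N j X U : stable_summand X U -> extv N j U -> extv N j X.
Proof. by move=> XU; apply/stable_summand_ext1v/stable_summand_syzygies. Qed.

Lemma extv_iso N j X U : isomorphic X U -> extv N j U -> extv N j X.
Proof. by move=> /stable_summand_iso; exact: extv_stable_summand. Qed.

(** Schanuel's lemma in stable form: the kernel of any projective presentation can replace the
    canonical syzygy. *)
Lemma stable_summand_Omega K P A (i : {linear K -> P}) (e : {linear P -> A}) :
  ses i e -> projective P -> stable_summand K (Omega A) /\ stable_summand (Omega A) K.
Proof.
move=> sie projP.
by split; apply: stable_summand_syzygy (stable_summand_refl A);
  (exact: ses_Omega || exact: free_on_projective || eassumption).
Qed.

Definition zero_mod V : lmodType R := submod (kernel (@idfun V : {linear V -> V})).

Lemma zero_modP V : is_zero (zero_mod V).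
Proof. by move=> x; apply: val_inj; rewrite linear0; exact: (submod_kernelP x). Qed.

Lemma projective_is_zero Z : is_zero Z -> projective Z.
Proof. by move=> Z0 A B g h _; exists \0 => x; rewrite (Z0 x) !linear0. Qed.

Lemma extv_is_zero N j Z : is_zero Z -> extv N j Z.
Proof.
move=> Z0; have projZ := projective_is_zero Z0.
elim: j => [|j IHj]; first exact: ext1v_projective.
rewrite extvS; have [] := @stable_summand_Omega Z Z Z \0 idfun _ projZ.
  split=> [x y _|x|x]; first by rewrite (Z0 x) (Z0 y).
    by exists x.
  by split=> _; [exists 0; exact/esym/(Z0 x) | exact: (Z0 x)].
by move=> _ OZ; exact: extv_stable_summand OZ IHj.
Qed.

(** Stably, a projective module is a summand of zero. *)
Lemma extv_projective N j P : projective P -> extv N j P.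
Proof.
move=> projP; apply: (@extv_stable_summand _ _ _ (zero_mod P)).
  by exists P, \0, idfun, \0, idfun; split=> // x; rewrite /= add0r.
exact/extv_is_zero/zero_modP.
Qed.

Lemma extv_ses_mid N j K V A (i : {linear K -> V}) (e : {linear V -> A}) :
  ses i e -> extv N j K -> extv N j A -> extv N j V.
Proof.
elim: j K V A i e => [|j IHj] K V A i e sie; first exact: ext1v_ses_mid sie.
rewrite !extvS => vK vA.
have [H [iH [g [m [r [sH smr _]]]]]] :=
  horseshoe sie (ses_Omega K) (ses_Omega A) (@free_on_projective _ A).
have vH := IHj _ _ _ _ _ smr vK vA.
have [|_ OH] := stable_summand_Omega sH; last exact: extv_stable_summand OH vH.
by apply: projective_pair; exact: free_on_projective.
Qed.

(** One rotation puts K, up to a free summand, in the middle between the syzygy of A and V. *)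
Lemma extv_ses_left N j K V A (i : {linear K -> V}) (e : {linear V -> A}) :
  ses i e -> extv N j V -> extv N j.+1 A -> extv N j K.
Proof.
move=> sie vV; rewrite extvS => vA.
have [al [al' [alP al'P]]] :=
  ses_map_projective sie (ses_Omega A) (@free_on_projective _ A).
have [f [g [sfg _ _]]] := ses_rotate sie (ses_Omega A) alP al'P.
have := extv_ses_mid sfg vA vV.
exact/extv_stable_summand/stable_summand_fst.
Qed.

(** Two rotations put the syzygy of A, up to a free summand, in the middle between the syzygy of V
    and K, up to a free summand again. *)
Lemma extv_ses_right N j K V A (i : {linear K -> V}) (e : {linear V -> A}) :
  ses i e -> extv N j K -> extv N j.+1 V -> extv N j.+1 A.
Proof.
move=> sie vK; rewrite !extvS => vV.
have [al [al' [alP al'P]]] :=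
  ses_map_projective sie (ses_Omega A) (@free_on_projective _ A).
have [f [g [sfg _ _]]] := ses_rotate sie (ses_Omega A) alP al'P.
have [be [be' [beP be'P]]] :=
  ses_map_projective sfg (ses_Omega V) (@free_on_projective _ V).
have [f' [g' [sfg' _ _]]] := ses_rotate sfg (ses_Omega V) beP be'P.
have := @extv_ses_mid N j _ _ _ _ _ sfg' vV.
have vKF : extv N j (K * free_on A)%type.
  apply: extv_stable_summand vK; apply: stable_summand_pairl.
  exact: free_on_projective.
move/(_ vKF); exact/extv_stable_summand/stable_summand_fst.
Qed.

End ExtVanishing.

(** * Ext modules as cokernels of restriction maps, and dimension shifting *)

Section ExtModule.
Variables (R : comNzRingType).
Implicit Types A B D H K U V W X Z P N : lmodType R.

(* D is the cokernel of [Hom(V, N) -> Hom(K, N)]. *)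
Definition hom_coker K V N D (i : {linear K -> V}) :=
  exists tau : {linear {linear K -> N} -> D},
    surjective tau /\ forall h, tau h = 0 <-> extendable i h.

Lemma quo_pi_eq0 V (S : submodClosed V) (x : V) : quo_pi S x = 0 <-> x \in S.
Proof.
split=> [x0|Sx].
  by rewrite -[x]subr0; apply/quo_piP; rewrite x0 linear0.
by rewrite -(linear0 (quo_pi S)); apply/quo_piP; rewrite subr0.
Qed.

Lemma mem_imageP U V (f : {linear U -> V}) y : y \in Defs.image f <-> exists x, f x = y.
Proof. by split=> [/asboolP|?]; last exact/asboolP. Qed.

(** A cocycle on P_(j+1) is a map on the syzygy of index j+1 composed with the augmentation, and it
    is a coboundary exactly when that map extends to P_j. *)
Lemma Ext_hom_coker N A j : hom_coker N (Ext j.+1 A N) (Omega_incl (syzygy A j)).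
Proof.
set X := syzygy A j.
set d1 := precomp (free_diff A j.+1) N.
have [||b|sigma sigmaP] := @linear_choice _ {linear Omega X -> N} (submod (kernel d1))
    (fun h b => forall y, ker_incl d1 b y = h (augmentation (Omega X) y)).
- move=> h.
  have hk : (h \o augmentation (Omega X) : {linear free_res A j.+1 -> N})
      \in kernel (precomp (free_diff A j.+1) N).
    rewrite kernelE; apply/eqP/linear_ext => y /=.
    by have := submod_kernelP (augmentation (syzygy A j.+2) y) => ->; rewrite linear0.
  by exists (Submod hk).
- by move=> a x y x' y' xx yy z; rewrite linearP /= xx yy.
- by move=> b0; apply: val_inj; rewrite linear0; apply: linear_ext => y; rewrite b0.
pose tau : {linear {linear Omega X -> N} -> Ext j.+1 A N} := quo_pi _ \o sigma.
exists tau; split=> [d|h].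
  have := submod_kernelP (repr d); set g := val (repr d) => gd.
  have [|h hP] := ses_factor (g := g) (ses_Omega (Omega X)).
    move=> k; have [x <-] := augmentation_surj k.
    exact: (congr1 (fun u : {linear _ -> _} => u x) gd).
  exists h; rewrite /tau /= -[RHS]quo_reprK; congr (quo_pi _ _).
  by apply: val_inj; apply: linear_ext => x; rewrite -[RHS]hP; exact: sigmaP.
rewrite /tau /= quo_pi_eq0.
rewrite -[sigma h \in _]/(val (sigma h) \in Defs.image (precomp (free_diff A j) N)).
rewrite mem_imageP; split=> [[g gE]|[g gE]]; exists g.
  move=> k; have [x <-] := augmentation_surj k.
  by rewrite -sigmaP; exact: (congr1 (fun u : {linear _ -> _} => u x) gE).
by apply: linear_ext => x; rewrite -[RHS]/(ker_incl d1 (sigma h) x) sigmaP -gE.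
Qed.

Lemma Ext_eq0 N A j : is_zero (Ext j.+1 A N) <-> extv N j A.
Proof.
have [tau [tau_s tauP]] := Ext_hom_coker N A j.
split=> [E0|vA].
  apply: ext1v_of_extendable (ses_Omega _) _ _.
    exact/ext1v_projective/free_on_projective.
  by move=> h; apply/tauP; exact: E0.
by move=> d; have [h <-] := tau_s d; apply/tauP; exact: vA (ses_Omega _) _.
Qed.

Lemma Ext0_eq0 N A :
  is_zero (Ext 0 A N) <-> forall (h : {linear A -> N}) x, h x = 0.
Proof.
split=> [E0 h x|h0 d].
  have hk : (h \o augmentation A : {linear free_res A 0 -> N})
      \in kernel (precomp (free_diff A 0) N).
    rewrite kernelE; apply/eqP/linear_ext => y /=.
    by have := submod_kernelP (augmentation (syzygy A 1) y) => ->; rewrite linear0.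
  have /(congr1 val) := E0 (Submod hk).
  move/(congr1 (fun u : {linear _ -> N} => u << x >>)) => /=.
  by rewrite liftU scale1r.
have := submod_kernelP d; set g := val d => gd.
have [|h hP] := ses_factor (g := g) (ses_Omega A).
  move=> k; have [x <-] := augmentation_surj k.
  exact: (congr1 (fun u : {linear _ -> _} => u x) gd).
by apply: val_inj; rewrite linear0; apply: linear_ext => x; rewrite -[LHS]hP h0.
Qed.

Lemma hom_coker_iso K V V' N D D' (i : {linear K -> V}) (i' : {linear K -> V'}) :
  hom_coker N D i -> hom_coker N D' i' ->
  (forall h : {linear K -> N}, extendable i h <-> extendable i' h) ->
  isomorphic D D'.
Proof.
move=> [tau [tau_s tauP]] [tau' [tau'_s tau'P]] ii'.
have [||d|f fP] := @linear_choice _ D D' (fun d d' => exists2 h, tau h = d & tau' h = d').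
- by move=> d; have [h <-] := tau_s d; exists (tau' h), h.
- move=> a x y _ _ [h <- <-] [g <- <-]; exists (a *: h + g); by rewrite linearP.
- by move=> [h /tauP/ii'/tau'P h0 <-].
exists f; apply/bij_inj_surj; split.
  by apply: linear_inj0 => d; have [h <- <-] := fP d => /tau'P/ii'/tauP.
move=> d'; have [h hd'] := tau'_s d'.
exists (tau h); have [g gh <-] := fP (tau h).
rewrite -hd'; apply/eqP; rewrite -subr_eq0 -linearB; apply/eqP/tau'P/ii'/tauP.
by rewrite linearB gh subrr.
Qed.

(** The cokernel computed from a projective presentation is also computed by any presentation with
    acyclic middle term: restriction along K0 -> K induces the comparison, and the rotated sequence
    K0 -> K x P -> V shows it bijective. *)
Lemma hom_coker_acyclic K0 P A K V N D (j : {linear K0 -> P}) (p : {linear P -> A})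
    (i : {linear K -> V}) (e : {linear V -> A}) :
  ses j p -> projective P -> hom_coker N D j -> ses i e -> ext1v N V ->
  hom_coker N D i.
Proof.
move=> sjp projP [tau [tau_s tauP]] sie vV.
have [al [al' [alP al'P]]] := ses_map_projective sie sjp projP.
have [f [g [sfg fP gP]]] := ses_rotate sie sjp alP al'P.
pose pull : {linear {linear K -> N} -> {linear K0 -> N}} := precomp al' N.
exists (tau \o pull); split=> [d|h].
  have [u <-] := tau_s d.
  have [w wP] := vV _ _ _ _ sfg u.
  have [ik ikP] := pair_linear (@idfun K : {linear K -> K}) (\0 : {linear K -> P}).
  have [ip ipP] := pair_linear (\0 : {linear P -> K}) (@idfun P : {linear P -> P}).
  (* As [f] has first component - al', the minus sign makes the pulled back map differ from [u] by -
     w ip j, which extends to P. *)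
  exists (\- (w \o ik) : {linear K -> N}).
  rewrite /=; apply/eqP; rewrite -subr_eq0 -linearB; apply/eqP/tauP.
  exists (\- (w \o ip) : {linear P -> N}) => k /=.
  rewrite -wP fP -[in RHS]opprD -linearD; congr (- w _).
  by rewrite ikP ipP; congr pair => /=; rewrite ?addr0 ?add0r ?subrr.
rewrite /= tauP; split=> [[u uP]|[h' h'P]]; last first.
  by exists (h' \o al : {linear P -> N}) => k; rewrite /= -al'P h'P.
have [hu huP] := copair_linear h u.
have [|h' h'P] := ses_factor (g := hu) sfg.
  by move=> k; rewrite fP huP linearN uP /= addNr.
exists h' => k; have := h'P (k, 0).
by rewrite gP huP !linear0 !addr0.
Qed.

(** Stated for arbitrary cokernels D and D' so that the induction can rewrite syzygies inside the
    inclusions while the modules being compared stay fixed. *)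
Lemma Ext_shift_hom_coker N j K V A (i : {linear K -> V}) (e : {linear V -> A}) D D' :
  ses i e -> extv N j V -> extv N j.+1 V ->
  hom_coker N D (Omega_incl (syzygy K j)) -> hom_coker N D' (Omega_incl (syzygy A j.+1)) ->
  isomorphic D D'.
Proof.
elim: j K V A i e => [|j IHj] K V A i e sie vV; rewrite extvS => vOV DK DA;
  have [H [iH [g [m [r [sH smr mP]]]]]] :=
    horseshoe sie (ses_Omega K) (ses_Omega A) (@free_on_projective _ A);
  have [|HO OH] := stable_summand_Omega sH; try by
    apply: projective_pair; exact: free_on_projective.
(* The horseshoe sequence presents the syzygy of A with kernel the syzygy of K and acyclic middle
   term H. Both cokernels are now quotients of the same Hom module; since Ext^1(V, N) = 0, maps on H
   extend to the free modules, so the two notions of extendability agree. *)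
- have DA' := hom_coker_acyclic (ses_Omega (Omega A)) (@free_on_projective _ _) DA smr
    (extv_stable_summand HO vOV).
  apply: hom_coker_iso DK DA' _ => h; split=> [[u uP]|[u uP]].
    have [l lP] := copair_linear u (\0 : {linear free_on A -> N}).
    exists (l \o iH : {linear H -> N}) => k.
    by rewrite /= mP lP /= addr0 uP.
  have [w wP] := vV _ _ _ _ sH u.
  have [ik ikP] := pair_linear (@idfun (free_on K) : {linear _ -> free_on K})
    (\0 : {linear _ -> free_on A}).
  exists (w \o ik : {linear _ -> N}) => k.
  by rewrite /= ikP /= -uP -wP mP.
- rewrite syzygyS in DK; rewrite syzygyS in DA.
  apply: IHj smr _ _ DK DA; first by apply: extv_stable_summand HO _; rewrite -extvS.
  exact: extv_stable_summand HO vOV.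
Qed.

Lemma Ext_shift N j K V A (i : {linear K -> V}) (e : {linear V -> A}) :
  ses i e -> extv N j V -> extv N j.+1 V ->
  isomorphic (Ext j.+1 K N) (Ext j.+2 A N).
Proof.
move=> sie v1 v2.
exact: Ext_shift_hom_coker sie v1 v2 (Ext_hom_coker _ _ _) (Ext_hom_coker _ _ _).
Qed.

Lemma Ext1_hom_coker N K V A (i : {linear K -> V}) (e : {linear V -> A}) :
  ses i e -> extv N 0 V -> hom_coker N (Ext 1 A N) i.
Proof.
exact: hom_coker_acyclic (ses_Omega _) (@free_on_projective _ _) (Ext_hom_coker N A 0).
Qed.

Lemma extv_shift N j K V A (i : {linear K -> V}) (e : {linear V -> A}) :
  ses i e -> extv N j V -> extv N j.+1 V -> extv N j K <-> extv N j.+1 A.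
Proof.
by move=> sie v1 v2; split=> v; [exact: extv_ses_right sie v v2|exact: extv_ses_left sie v1 v].
Qed.

End ExtModule.

(** * Finite generation, Noetherian modules and dual bases *)

Section FiniteGeneration.
Variables (R : comNzRingType).
Implicit Types A B D H K U V W X Z P N F : lmodType R.

Lemma fin_gen_fintype V (I : finType) (g : I -> V) :
  (forall x, exists a : I -> R, x = \sum_i a i *: g i) -> fin_gen V.
Proof.
move=> gP; exists #|I|, (fun k => g (enum_val k)) => x.
have [a ->] := gP x; exists (fun k => a (enum_val k)).
by rewrite (reindex_onto enum_val enum_rank) => [|i _]; rewrite ?enum_rankK //;
  apply: eq_bigl => k; rewrite enum_valK eqxx.
Qed.

Lemma fin_gen_surj V A (e : {linear V -> A}) : surjective e -> fin_gen V -> fin_gen A.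
Proof.
move=> es [m [g gP]]; exists m, (e \o g) => x.
have [v <-] := es x; have [a ->] := gP v; exists a.
by rewrite linear_sum; apply: eq_bigr => i _; rewrite linearZ.
Qed.

Lemma fin_gen_ses K V A (i : {linear K -> V}) (e : {linear V -> A}) :
  ses i e -> fin_gen K -> fin_gen A -> fin_gen V.
Proof.
move=> [_ es ex] [m [g gP]] [n [h hP]].
have [h' h'P] := choice (fun k => es (h k)).
apply: (@fin_gen_fintype V ('I_m + 'I_n)%type
  (fun k => match k with inl k => i (g k) | inr k => h' k end)) => v.
have [b bP] := hP (e v).
have [|k ik] := (ex (v - \sum_l b l *: h' l)).1.
  rewrite linearB bP linear_sum; apply/eqP; rewrite subr_eq0; apply/eqP.
  by apply: eq_bigr => l _; rewrite linearZ h'P.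
have [a aP] := gP k.
exists (fun k => match k with inl k => a k | inr k => b k end).
rewrite big_sumType /= -[LHS](subrK (\sum_l b l *: h' l)) -ik; congr (_ + _).
by rewrite aP linear_sum; apply: eq_bigr => l _; rewrite linearZ.
Qed.

Lemma fin_gen_is_zero Z : is_zero Z -> fin_gen Z.
Proof.
move=> Z0; exists 0, (fun=> 0) => x; exists (fun=> 0).
by rewrite big_ord0; exact: Z0.
Qed.

Definition noetherian_mod V :=
  forall K (i : {linear K -> V}), injective i -> fin_gen K.

Lemma noetherian_mod_ses K V A (i : {linear K -> V}) (e : {linear V -> A}) :
  ses i e -> noetherian_mod K -> noetherian_mod A -> noetherian_mod V.
Proof.
move=> sie nK nA W f fi.
pose ef : {linear W -> A} := e \o f.
have [||y|g gP] := @linear_choice _ W (submod (Defs.image ef))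
    (fun w y => val y = ef w).
- move=> w; have ew : ef w \in Defs.image ef by apply/mem_imageP; exists w.
  by exists (Submod ew).
- by move=> a x y x' y' xx yy; rewrite !linearP -[LHS]/(a *: val x' + val y') xx yy.
- by rewrite linear0 => y0; apply: val_inj.
have gs : surjective g.
  move=> y; have /mem_imageP[w wy] := valP y.
  by exists w; apply: val_inj; rewrite gP.
apply: (fin_gen_ses (ses_kernel gs)).
  have [|l lP] := ses_lift (g := f \o ker_incl g) sie.
    by move=> k; rewrite -[LHS]gP (ses_comp0 (ses_kernel gs)).
  apply: (nK _ l) => k k' lk; apply: (@val_inj _ _ (submod (kernel g))).
  by apply: fi; rewrite -[LHS]lP lk lP.
pose v : {linear submod (Defs.image ef) -> A} := val.
by apply: (nA _ v); exact: val_inj.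
Qed.

Lemma noetherian_mod_surj V A (e : {linear V -> A}) :
  surjective e -> noetherian_mod V -> noetherian_mod A.
Proof.
move=> es nV K i ii.
have [W [j [p [q [[_ qs _] epq _ pq_inj _]]]]] := ses_pullback i (ses_kernel es).
apply: (fin_gen_surj qs); apply: (nV _ p) => w w' pw.
by apply: pq_inj => //; apply: ii; rewrite -!epq pw.
Qed.

Lemma scale_linear V (x : V) : exists f : {linear R^o -> V}, forall a, f a = a *: x.
Proof.
have lin : linear (fun a : R^o => (a : R) *: x).
  by move=> a b c; rewrite scalerDl scalerA.
by exists (mk_linear lin).
Qed.

Lemma noetherian_mod_regular : noetherian R -> noetherian_mod R^o.
Proof.
move=> nR K i ii.
have [||y|g gP] := @linear_choice _ (submod (Defs.image i)) K (fun y w => i w = val y).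
- by move=> y; exact/mem_imageP/(valP y).
- by move=> a x y x' y' xx yy; rewrite linearP xx yy.
- by rewrite linear0 => iy; apply: ii; rewrite iy linear0.
apply: (fin_gen_surj (e := g)); last exact: nR.
move=> k; have ik : i k \in Defs.image i by apply/mem_imageP; exists k.
by exists (Submod ik); apply: ii; rewrite gP.
Qed.

Lemma noetherian_fin_gen V : noetherian R -> fin_gen V -> noetherian_mod V.
Proof.
move=> nR [m [g gP]].
(* F is an iterated product of copies of [R^o], so that each factor is one application of closure
   under extensions. *)
have [F [phi [nF phiP]]] : exists F (phi : {linear F -> V}), noetherian_mod F /\
    forall a : 'I_m -> R, exists x, phi x = \sum_i a i *: g i.
  elim: m g {gP} => [|m IHm] g.
    exists (zero_mod V), \0; split; last by move=> a; exists 0; rewrite big_ord0.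
    move=> K i ii; apply: fin_gen_is_zero => k; apply: ii.
    by rewrite [LHS]zero_modP [RHS]zero_modP.
  have [F [phi [nF phiP]]] := IHm (fun i => g (fintype.lift ord0 i)).
  have [s sP] := scale_linear (g ord0).
  have [f fP] := copair_linear s phi.
  exists (R^o * F)%type, f; split=> [|a].
    have [i [si _]] := ses_pair R^o F.
    by apply: (noetherian_mod_ses si) => //; exact: noetherian_mod_regular.
  have [x xP] := phiP (fun i => a (fintype.lift ord0 i)).
  by exists (a ord0, x); rewrite fP sP xP big_ord_recl.
apply: (noetherian_mod_surj (e := phi)) => // v.
by have [a ->] := gP v; exact: phiP.
Qed.

(** The dual basis criterion for finite projective modules. It gives explicit formulas for maps out
    of P, for the duals of P and for tensor products with the dual. *)
Definition has_dual_basis P := exists (m : nat) (x : 'I_m -> P)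
  (phi : 'I_m -> {linear P -> R^o}), forall u, u = \sum_i (phi i u : R) *: x i.

Lemma dual_basis_fin_gen P : has_dual_basis P -> fin_gen P.
Proof.
by move=> [m [x [phi P_]]]; exists m, x => u; exists (fun i => phi i u).
Qed.

Lemma sum_linear U V (m : nat) (f : 'I_m -> {linear U -> V}) :
  exists g : {linear U -> V}, forall u, g u = \sum_i f i u.
Proof.
have lin : linear (fun u => \sum_i f i u).
  move=> a x y; rewrite scaler_sumr -big_split /=.
  by apply: eq_bigr => i _; rewrite linearP.
by exists (mk_linear lin).
Qed.

Lemma functional_linear U V (phi : {linear U -> R^o}) (v : V) :
  exists f : {linear U -> V}, forall u, f u = (phi u : R) *: v.
Proof.
have [s sP] := scale_linear v.
by exists (s \o phi : {linear U -> V}) => u; rewrite /= sP.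
Qed.

Lemma dual_basis_projective P : has_dual_basis P -> projective P.
Proof.
move=> [m [x [phi P_]]] A B g h gs.
have [a aP] := choice (fun i => gs (h (x i))).
have [f fP] := choice (fun i => functional_linear (phi i) (a i)).
have [s sP] := sum_linear f.
exists s => u; rewrite sP linear_sum {2}[u]P_ linear_sum.
by apply: eq_bigr => i _; rewrite fP !linearZ aP.
Qed.

Lemma fin_free_cover V : fin_gen V ->
  exists F (phi : {linear F -> V}), has_dual_basis F /\ surjective phi.
Proof.
move=> [m [g gP]].
have lin : linear (fun v : {ffun 'I_m -> R^o} => \sum_i (v i : R) *: g i).
  move=> a x y; rewrite scaler_sumr -big_split /=; apply: eq_bigr => i _.
  by rewrite !ffunE scalerDl scalerA.
exists {ffun 'I_m -> R^o}, (mk_linear lin); split.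
  have co i : linear (fun v : {ffun 'I_m -> R^o} => v i).
    by move=> a x y; rewrite !ffunE.
  exists m, (fun i => [ffun j => (i == j)%:R]), (fun i => mk_linear (co i)) => u.
  apply/ffunP => j; rewrite sum_ffunE (bigD1 j) //= big1 ?addr0 => [|i /negPf ij].
    by rewrite !ffunE eqxx; exact/esym/mulr1.
  by rewrite !ffunE ij; exact: mulr0.
move=> v; have [a ->] := gP v; exists [ffun i => a i].
by apply: eq_bigr => i _; rewrite ffunE.
Qed.

Lemma dual_basis_retract P F (s : {linear P -> F}) (p : {linear F -> P}) :
  cancel s p -> has_dual_basis F -> has_dual_basis P.
Proof.
move=> sK [m [x [phi F_]]]; exists m, (p \o x), (fun i => phi i \o s) => u.
rewrite -{1}[u]sK {1}[s u]F_ linear_sum.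
by apply: eq_bigr => i _; rewrite linearZ.
Qed.

Lemma projective_dual_basis P : projective P -> fin_gen P -> has_dual_basis P.
Proof.
move=> projP /fin_free_cover[F [phi [dF phi_s]]].
have [s sP] := projective_lift (@idfun P : {linear P -> P}) projP phi_s.
exact: dual_basis_retract sP dF.
Qed.

Lemma dual_basis_hom_expand P N (m : nat) (x : 'I_m -> P)
    (phi : 'I_m -> {linear P -> R^o}) :
  (forall u, u = \sum_i (phi i u : R) *: x i) ->
  forall (h : {linear P -> N}) u, h u = \sum_i (phi i u : R) *: h (x i).
Proof.
move=> P_ h u; rewrite {1}[u]P_ linear_sum.
by apply: eq_bigr => i _; rewrite linearZ.
Qed.

(** Hom(V, N) embeds in Hom(F, N) for a finite free cover F of V, and the latter is spanned by the
    products of a coordinate functional with a generator of N. *)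
Lemma fin_gen_hom V N : noetherian R -> fin_gen V -> fin_gen N ->
  fin_gen {linear V -> N}.
Proof.
move=> nR /fin_free_cover[F [p [[m [x [phi F_]]] ps]]] [k [c cP]].
have FN : fin_gen {linear F -> N}.
  have [f fP] := choice (fun ij : 'I_m * 'I_k => functional_linear (phi ij.1) (c ij.2)).
  apply: (@fin_gen_fintype _ _ f) => h.
  have [a aP] := choice (fun i => cP (h (x i))).
  exists (fun ij => a ij.1 ij.2); apply: linear_ext => u.
  rewrite (dual_basis_hom_expand F_ h).
  transitivity (\sum_ij (a ij.1 ij.2 *: f ij) u); last first.
    elim: (index_enum _) => [|ij r IHr]; first by rewrite !big_nil.
    by rewrite !big_cons IHr.
  rewrite (eq_bigr (fun ij => (a ij.1 ij.2 *: f (ij.1, ij.2)) u)) => [|[]//].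
  rewrite -(pair_bigA _ (fun i j => (a i j *: f (i, j)) u)) /=.
  apply: eq_bigr => i _; rewrite aP scaler_sumr; apply: eq_bigr => j _.
  by rewrite fP !scalerA mulrC.
apply: (noetherian_fin_gen nR FN (i := precomp p N)) => h h' hh.
apply: linear_ext => v; have [u <-] := ps v.
exact: (congr1 (fun f : {linear _ -> _} => f u) hh).
Qed.

Lemma dual_dual_basis P : has_dual_basis P -> has_dual_basis {linear P -> R^o}.
Proof.
move=> [m [x [phi P_]]].
exists m, phi, (fun i => biduality R^o (x i)) => h; apply: linear_ext => u.
transitivity (\sum_i (((h (x i) : R) *: phi i) u : R^o)); last first.
  elim: (index_enum _) => [|i r IHr]; first by rewrite !big_nil.
  by rewrite !big_cons IHr.
rewrite (dual_basis_hom_expand P_); apply: eq_bigr => i _; exact: mulrC.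
Qed.

End FiniteGeneration.

(** * Totally C-reflexive modules in short exact sequences *)

Section Reflexivity.
Variables (R : comNzRingType) (C : lmodType R).
Implicit Types A B D H K U V W X Z P N F : lmodType R.

Definition torsionless X :=
  forall x : X, (forall h : {linear X -> C}, h x = 0) -> x = 0.

Definition bidual_evaluation X :=
  forall Psi : {linear {linear X -> C} -> C}, exists x, forall h, Psi h = h x.

Lemma bidualityP X :
  bijective (@biduality R X C) <-> torsionless X /\ bidual_evaluation X.
Proof.
split=> [[g gK Kg]|[tX eX]]; first split.
- move=> x x0; rewrite -[x]gK -[0]gK; congr (g _); apply: linear_ext => h.
  by rewrite -[LHS]/(h x) -[RHS]/(h 0) x0 linear0.
- by move=> Psi; exists (g Psi) => h; rewrite -[Psi in LHS]Kg.
have [g gP] := choice eX.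
exists g => [x|Psi]; last by apply: linear_ext => h; exact/esym/gP.
apply/eqP; rewrite eq_sym -subr_eq0; apply/eqP/tX => h.
by rewrite linearB -gP subrr.
Qed.

Lemma totally_reflexiveP X :
  totally_reflexive C X <->
  [/\ fin_gen X, torsionless X /\ bidual_evaluation X,
      forall j, extv C j X & forall j, extv C j {linear X -> C}].
Proof.
split=> [[fX /bidualityP bX eX eX']|[fX /bidualityP bX eX eX']]; split=> //.
- by move=> j; apply/Ext_eq0/eX.
- by move=> j; apply/Ext_eq0/eX'.
- by case=> // j _; apply/Ext_eq0.
- by case=> // j _; apply/Ext_eq0.
Qed.

Lemma dual_ses K V A (i : {linear K -> V}) (e : {linear V -> A}) :
  ses i e -> extv C 0 A -> ses (precomp e C) (precomp i C).
Proof.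
move=> sie vA; have [_ es _] := sie; split=> [h h' hh|h|h].
- apply: linear_ext => a; have [v <-] := es a.
  exact: (congr1 (fun u : {linear _ -> _} => u v) hh).
- by have [h' h'P] := vA _ _ _ _ sie h; exists h'; exact: linear_ext.
- split=> [hi|[g <-]]; last first.
    by apply: linear_ext => k; rewrite /= (ses_comp0 sie) linear0.
  have [|g gP] := ses_factor (g := h) sie.
    by move=> k; exact: (congr1 (fun u : {linear _ -> _} => u k) hi).
  by exists g; exact: linear_ext.
Qed.

Variables (R_noetherian : noetherian R) (C_semidualizing : semidualizing C).

Lemma fin_gen_C : fin_gen C. Proof. by case: C_semidualizing. Qed.

Lemma C_faithful (a : R) : (forall c : C, a *: c = 0) -> a = 0.
Proof.
move=> aC; have [_ [g gK _] _] := C_semidualizing.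
rewrite -[a]gK -[0 : R]gK; congr (g _); apply: linear_ext => c.
by rewrite /= aC scale0r.
Qed.

Lemma C_endo (u : {linear C -> C}) : exists a : R, forall c, u c = a *: c.
Proof.
have [_ [g _ gK] _] := C_semidualizing.
by exists (g u) => c; rewrite -[in LHS](gK u).
Qed.

Lemma extv_C j : extv C j C.
Proof. by have [_ _ eC] := C_semidualizing; apply/Ext_eq0/eC. Qed.

Lemma totally_reflexive_dual X :
  totally_reflexive C X -> totally_reflexive C {linear X -> C}.
Proof.
move=> /totally_reflexiveP[fX [tX eX] vX vX']; apply/totally_reflexiveP; split=> //.
- exact: fin_gen_hom R_noetherian fX fin_gen_C.
- split=> [h h0|Phi].
    by apply: linear_ext => x; exact: (h0 (biduality C x)).
  have lin : linear (fun x : X => Phi (biduality C x)).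
    by move=> a x y; rewrite -linearP; congr (Phi _); apply: linear_ext => h; exact: linearP.
  exists (mk_linear lin) => Psi; have [x xP] := eX Psi.
  by rewrite xP; congr (Phi _); exact: linear_ext.
- move=> j; apply: extv_iso (vX j); apply: isomorphic_sym.
  have lin : linear (fun x : X => biduality C x).
    by move=> a x y; apply: linear_ext => h; exact: linearP.
  by exists (mk_linear lin); apply/bidualityP.
Qed.

Lemma totally_reflexive_ses_left K V A (i : {linear K -> V}) (e : {linear V -> A}) :
  ses i e -> totally_reflexive C V -> totally_reflexive C A -> totally_reflexive C K.
Proof.
move=> sie /totally_reflexiveP[fV [tV eV] vV vV'] /totally_reflexiveP[fA [tA eA] vA vA'].
(* The element of K representing [Psi] is found in V, where [Psi] composed with restriction is an
   evaluation; it lies in K because functionals coming from A are killed. *)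
have [ii es ex] := sie.
have sd := dual_ses sie (vA 0).
apply/totally_reflexiveP; split.
- exact: noetherian_fin_gen R_noetherian fV _ _ ii.
- split=> [k k0|Psi].
    by apply: ii; rewrite linear0; apply: tV => h; exact: (k0 (precomp i C h)).
  have [v vP] := eV (Psi \o precomp i C : {linear _ -> _}).
  have [|k ik] := (ex v).1.
    apply: tA => h; rewrite -[LHS](vP (precomp e C h)) /= -[RHS](linear0 Psi).
    by congr (Psi _); exact: (ses_comp0 sd).
  exists k => h; have [h' h'P] := vA 0 _ _ _ _ sie h.
  rewrite -h'P ik -vP /=; congr (Psi _); exact/esym/linear_ext.
- by move=> j; exact: extv_ses_left sie (vV j) (vA j.+1).
- case=> [|j]; last exact: extv_ses_right sd (vA' j) (vV' j.+1).
  (* Degree one is not covered by shifting. A functional on the dual of A is evaluation at some a,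
     and evaluation at a lift of a to V extends it. *)
  apply: ext1v_of_extendable sd (vV' 0) _ => Psi.
  have [a aP] := eA Psi; have [v va] := es a.
  by exists (biduality C v) => h; rewrite aP -va.
Qed.

Lemma totally_reflexive_ses_mid K V A (i : {linear K -> V}) (e : {linear V -> A}) :
  ses i e -> totally_reflexive C K -> totally_reflexive C A -> totally_reflexive C V.
Proof.
move=> sie /totally_reflexiveP[fK [tK eK] vK vK'] /totally_reflexiveP[fA [tA eA] vA vA'].
have [ii es ex] := sie.
have sd := dual_ses sie (vA 0).
apply/totally_reflexiveP; split.
- exact: fin_gen_ses sie fK fA.
- split=> [v v0|Psi].
    have [|k ik] := (ex v).1; first by apply: tA => h; exact: (v0 (precomp e C h)).
    rewrite -ik (tK k) ?linear0 // => h.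
    by have [h' <-] := vA 0 _ _ _ _ sie h; rewrite ik v0.
  have [a aP] := eA (Psi \o precomp e C : {linear _ -> _}); have [v va] := es a.
  pose Psi' : {linear {linear V -> C} -> C} := Psi \- biduality C v.
  have [|Phi PhiP] := ses_factor (g := Psi') sd.
    move=> h; rewrite /Psi' /=; apply/eqP; rewrite subr_eq0; apply/eqP.
    by rewrite [LHS]aP -va.
  have [k kP] := eK Phi; exists (v + i k) => h.
  rewrite linearD; have := PhiP h; rewrite kP /Psi' /= => ->.
  by rewrite addrC subrK.
- by move=> j; exact: extv_ses_mid sie (vK j) (vA j).
- by move=> j; exact: extv_ses_mid sd (vA' j) (vK' j).
Qed.

(** Since Ext^1(A, C) = 0, dualizing keeps the sequence exact and makes the dual of A the kernel of
    a surjection between totally reflexive modules. *)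
Lemma totally_reflexive_ses_right K V A (i : {linear K -> V}) (e : {linear V -> A}) :
  ses i e -> totally_reflexive C K -> totally_reflexive C V -> extv C 0 A ->
  totally_reflexive C A.
Proof.
move=> sie TK TV vA0; have [ii es ex] := sie.
have sd := dual_ses sie vA0.
have vA' j : extv C j {linear A -> C}.
  have := totally_reflexive_ses_left sd (totally_reflexive_dual TV) (totally_reflexive_dual TK).
  by case/totally_reflexiveP.
move: TK TV => /totally_reflexiveP[fK [tK eK] vK vK'] /totally_reflexiveP[fV [tV eV] vV vV'].
apply/totally_reflexiveP; split=> //.
- exact: fin_gen_surj es fV.
- split=> [a a0|Psi].
    have [v va] := es a.
    have [|Phi PhiP] := ses_factor (g := biduality C v) sd.
      by move=> h; rewrite -[RHS](a0 h) -va.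
    have [k kP] := eK Phi.
    rewrite -va; apply/ex; exists k; apply/eqP; rewrite -subr_eq0; apply/eqP/tV => h.
    by rewrite linearB -[h v]PhiP kP subrr.
  have [Phi PhiP] := vK' 0 _ _ _ _ sd Psi.
  have [v vP] := eV Phi; exists (e v) => h.
  by rewrite -PhiP vP.
- by case=> // j; exact: extv_ses_right sie (vK j) (vV j.+1).
Qed.

(** Y is the kernel of X -> 0, so closure under kernels applies. *)
Lemma totally_reflexive_iso X Y : isomorphic X Y ->
  totally_reflexive C X -> totally_reflexive C Y.
Proof.
move=> /isomorphic_sym[f /bij_inj_surj[fi fs]] TX.
have Z0 := @zero_modP R X.
have TZ : totally_reflexive C (zero_mod X).
  apply/totally_reflexiveP; split.
  - exact: fin_gen_is_zero.
  - split=> [x _|Psi]; first exact: Z0.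
    exists 0 => h; rewrite linear0 -[RHS](linear0 Psi); congr (Psi _).
    by apply: linear_ext => x; rewrite (Z0 x) !linear0.
  - by move=> j; exact: extv_is_zero.
  - move=> j; apply: extv_is_zero => h.
    by apply: linear_ext => x; rewrite (Z0 x) !linear0.
have sf : ses f (\0 : {linear X -> zero_mod X}).
  by split=> // x; exists 0; rewrite (Z0 x) linear0.
exact: totally_reflexive_ses_left sf TX TZ.
Qed.

(* X is a summand of a power of C. *)
Lemma extv_summand_power X (m : nat) (a : 'I_m -> {linear X -> C})
    (b : 'I_m -> {linear C -> X}) :
  (forall x, x = \sum_i b i (a i x)) -> forall j, extv C j X.
Proof.
move=> idX j.
have [U [f [g [vU gf]]]] : exists U (f : {linear X -> U}) (g : {linear U -> X}),
    extv C j U /\ forall x, g (f x) = \sum_i b i (a i x).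
  elim: m a b {idX} => [|m IHm] a b.
    exists (zero_mod C), \0, \0; split; first exact/extv_is_zero/zero_modP.
    by move=> x; rewrite big_ord0.
  have [U [f [g [vU gf]]]] :=
    IHm (fun i => a (fintype.lift ord0 i)) (fun i => b (fintype.lift ord0 i)).
  have [f' f'P] := pair_linear (a ord0) f.
  have [g' g'P] := copair_linear (b ord0) g.
  exists (C * U)%type, f', g'; split=> [|x].
    by have [i [si _]] := ses_pair C U; exact: extv_ses_mid si (@extv_C j) vU.
  by rewrite f'P g'P gf big_ord_recl.
apply: extv_stable_summand vU.
exists (free_on X), f, \0, g, \0; split; first exact: free_on_projective.
by move=> x; rewrite gf -idX /= addr0.
Qed.

Lemma hom_sumE U V (m : nat) (f : 'I_m -> {linear U -> V}) u :
  (\sum_i f i) u = \sum_i f i u.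
Proof.
elim: (index_enum _) => [|i r IHr]; first by rewrite !big_nil.
by rewrite !big_cons -IHr.
Qed.

Lemma functional_hom_linear P (phi : {linear P -> R^o}) :
  exists b : {linear C -> {linear P -> C}}, forall c u, b c u = (phi u : R) *: c.
Proof.
have [||h|b bP] := @linear_choice _ C {linear P -> C}
  (fun c h => forall u, h u = (phi u : R) *: c).
- by move=> c; exact: functional_linear.
- by move=> a c d h g hE gE u; rewrite /= hE gE scalerDr !scalerA mulrC.
- by move=> h0; apply: linear_ext => u; rewrite h0 scaler0.
by exists b.
Qed.

Lemma totally_reflexive_projective P :
  projective P -> fin_gen P -> totally_reflexive C P.
Proof.
move=> projP fP; have [m [x [phi P_]]] := projective_dual_basis projP fP.
have [b bP] := choice (fun i => functional_hom_linear (phi i)).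
have hE (h : {linear P -> C}) : h = \sum_i b i (h (x i)).
  apply: linear_ext => u; rewrite (dual_basis_hom_expand P_ h) hom_sumE.
  by apply: eq_bigr => i _; rewrite bP.
apply/totally_reflexiveP; split=> //.
- split=> [u u0|Psi].
    rewrite [u]P_; apply: big1 => i _.
    rewrite (C_faithful (a := phi i u)) ?scale0r // => c.
    by rewrite -bP u0.
  (* On each of the m copies of C, [Psi] is an endomorphism of C and hence a homothety; its ratios
     are the coordinates of the representing element. *)
  have [r rP] := choice (fun i => C_endo (Psi \o b i : {linear C -> C})).
  exists (\sum_i r i *: x i) => h; rewrite {1}[h]hE !linear_sum.
  by apply: eq_bigr => i _; rewrite [RHS]linearZ; exact: rP.
- by move=> j; exact: extv_projective.
- exact: (@extv_summand_power _ m (fun i => biduality C (x i)) b).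
Qed.

End Reflexivity.

(** * G_C-dimension, syzygies by totally reflexive modules, and the duality *)

Section GDimension.
Variables (R : comNzRingType) (C : lmodType R).
Variables (R_noetherian : noetherian R) (C_semidualizing : semidualizing C).
Implicit Types A B D H K U V W X Z P N F : lmodType R.

Let TR_left := @totally_reflexive_ses_left R C R_noetherian.
Let TR_dual := @totally_reflexive_dual R C R_noetherian C_semidualizing.

(** A resolution cut into short exact sequences, the form suited to induction. *)
Fixpoint Gdim_le n M : Prop :=
  if n is m.+1 then
    exists (K V : lmodType R) (i : {linear K -> V}) (e : {linear V -> M}),
      [/\ ses i e, totally_reflexive C V & Gdim_le m K]
  else totally_reflexive C M.

Lemma Gdim_le_fin_gen n M : Gdim_le n M -> fin_gen M.
Proof.
case: n => [[]//|n [K [V [i [e [[_ es _] [fV _ _ _] _]]]]]].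
exact: fin_gen_surj es fV.
Qed.

Lemma Gdim_le_extv n M j : Gdim_le n M -> (n <= j)%N -> extv C j M.
Proof.
elim: n M j => [|n IHn] M j; first by move=> /totally_reflexiveP[].
case: j => // j [K [V [i [e [sie /totally_reflexiveP[_ _ vV _] dK]]]]] nj.
exact: extv_ses_right sie (IHn _ _ dK nj) (vV j.+1).
Qed.

Lemma Gdim_le_ses_mid n K V A (i : {linear K -> V}) (e : {linear V -> A}) :
  ses i e -> Gdim_le n K -> totally_reflexive C A -> Gdim_le n V.
Proof.
elim: n K V A i e => [|n IHn] K V A i e sie.
  exact: totally_reflexive_ses_mid sie.
move=> [K2 [V1 [i1 [e1 [si1 TV1 dK2]]]]] TA; have [fA _ _ _] := TA.
(* The horseshoe needs a projective module over A; the kernel of a finite free cover of A is again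
   totally reflexive, so the induction continues. *)
have [P [p [dP ps]]] := fin_free_cover fA.
have projP := dual_basis_projective dP.
have TP := totally_reflexive_projective C_semidualizing projP (dual_basis_fin_gen dP).
have [H [iH [g [j [r [sH sjr _]]]]]] := horseshoe sie si1 (ses_kernel ps) projP.
exists H, (V1 * P)%type, iH, g; split=> //.
  by have [l [sl _]] := ses_pair V1 P; exact: totally_reflexive_ses_mid sl TV1 TP.
exact: (IHn _ _ _ _ _ sjr dK2 (TR_left (ses_kernel ps) TP TA)).
Qed.

(** If W -> V starts a resolution of V, then the kernel of W -> A is totally reflexive and maps onto
    K with the same kernel as W -> V. *)
Lemma Gdim_le_ses_left n K V A (i : {linear K -> V}) (e : {linear V -> A}) :
  ses i e -> Gdim_le n V -> totally_reflexive C A -> Gdim_le n K.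
Proof.
case: n => [|n] sie; first by move=> TV TA; exact: (TR_left sie TV TA).
move=> [V2 [W [i1 [e1 [si1 TW dV2]]]]] TA.
have [ii es ex] := sie; have [i1i e1s ex1] := si1.
have ee1s : surjective (e \o e1).
  by move=> a; have [v <-] := es a; have [w <-] := e1s v; exists w.
have sk := ses_kernel ee1s; have [ki _ kx] := sk.
have [|l lP] := ses_lift (g := e1 \o ker_incl (e \o e1)) sie.
  exact: (ses_comp0 sk).
have [|m mP] := ses_lift (g := i1) sk.
  by move=> x; rewrite /= (ses_comp0 si1) linear0.
exists V2, (submod (kernel (e \o e1))), m, l; split=> //; last exact: TR_left sk TW TA.
split=> [x y mxy|k|w].
- by apply: i1i; rewrite -!mP mxy.
- have [w ew] := e1s (i k).
  have [|w' w'w] := (kx w).1; first by rewrite /= ew (ses_comp0 sie).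
  by exists w'; apply: ii; rewrite lP -ew -w'w.
- split=> [lw|[x <-]]; last first.
    by apply: ii; rewrite lP linear0 -[RHS](ses_comp0 si1 x) -mP.
  have [|x xP] := (ex1 (ker_incl (e \o e1) w)).1.
    by have := lP w; rewrite lw linear0.
  by exists x; apply: ki; rewrite mP.
Qed.

(** Any totally reflexive cover lowers the dimension, not just one from a shortest resolution: in
    Schanuel's square W is an extension of V by K', and K is the kernel of W -> V'. *)
Lemma Gdim_le_kernel n K V A (i : {linear K -> V}) (e : {linear V -> A}) :
  ses i e -> totally_reflexive C V -> Gdim_le n.+1 A -> Gdim_le n K.
Proof.
move=> sie TV [K' [V' [i' [e' [sie' TV' dK']]]]].
have [W [j [m [p [q [sjq smp _ _]]]]]] := ses_pullback_sym sie sie'.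
exact: Gdim_le_ses_left smp (Gdim_le_ses_mid sjq dK' TV) TV'.
Qed.

(** The recursion runs on the side of B because the duality produces the sequence starting from its
    left end. *)
Fixpoint G_syzygy n D B : Prop :=
  if n is m.+1 then
    exists (V B' : lmodType R) (i : {linear B -> V}) (e : {linear V -> B'}),
      [/\ ses i e, totally_reflexive C V & G_syzygy m D B']
  else B = D.

Lemma G_syzygy_Gdim_le n t D B : G_syzygy n D B -> Gdim_le (n + t) D -> Gdim_le t B.
Proof.
elim: n t B => [|n IHn] t B; first by move=> ->.
move=> [V [B' [i [e [sie TV sB']]]]]; rewrite addSnnS => /(IHn _ _ sB').
exact: Gdim_le_kernel sie TV.
Qed.

Lemma Gdim_le_of_G_syzygy n t D B :
  G_syzygy n D B -> Gdim_le t B -> Gdim_le (n + t) D.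
Proof.
elim: n t B => [|n IHn] t B; first by move=> ->.
move=> [V [B' [i [e [sie TV sB']]]]] dB; rewrite addSnnS; apply: IHn sB' _.
by exists B, V, i, e.
Qed.

Lemma G_syzygy_Ext n j D B :
  G_syzygy n D B -> isomorphic (Ext j.+1 B C) (Ext (n + j).+1 D C).
Proof.
elim: n j B => [|n IHn] j B; first by move=> ->; exact: isomorphic_refl.
move=> [V [B' [i [e [sie /totally_reflexiveP[_ _ vV _] sB']]]]].
rewrite addSnnS; exact: isomorphic_trans (Ext_shift sie (vV j) (vV j.+1)) (IHn _ _ sB').
Qed.

Lemma isomorphic_is_zero U V : isomorphic U V -> is_zero U -> is_zero V.
Proof.
by move=> [f /bij_inj_surj[_ fs]] U0 v; have [u <-] := fs v; rewrite (U0 u) linear0.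
Qed.

Lemma G_syzygy_extv n j D B : G_syzygy n D B -> extv C j B <-> extv C (n + j) D.
Proof.
move=> /(@G_syzygy_Ext _ j) iso.
by split=> /Ext_eq0 v; apply/Ext_eq0; apply: isomorphic_is_zero v => //; exact: isomorphic_sym.
Qed.

(** Left exactness embeds the cokernel B of the dual of e in the dual of K. A functional on B,
    pulled back to the dual of V, is evaluation at some v; it kills the functionals from A, so when
    A is torsionless v lies in K. *)
Lemma dual_coker_embedding K V A (i : {linear K -> V}) (e : {linear V -> A}) B
    (q : {linear {linear V -> C} -> B}) :
  ses i e -> totally_reflexive C V -> surjective q ->
  (forall h, q h = 0 <-> exists g : {linear A -> C}, forall v, h v = g (e v)) ->
  exists m : {linear B -> {linear K -> C}},
    [/\ injective m, forall h k, m (q h) k = h (i k)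
      & torsionless C A ->
        forall psi : {linear B -> C}, exists k, forall b, psi b = m b k].
Proof.
move=> sie /totally_reflexiveP[_ [tV eV] _ _] qs qP; have [ii es ex] := sie.
have [||k|m mP] := @linear_choice _ B {linear K -> C}
  (fun b u => exists2 h, q h = b & forall k, u k = h (i k)).
- by move=> b; have [h hb] := qs b; exists (h \o i : {linear K -> C}), h.
- move=> a x y u w [h <- uP] [g <- wP]; exists (a *: h + g); first exact: linearP.
  by move=> k; rewrite /= uP wP.
- move=> [h /qP[g gP] kP]; apply: linear_ext => x.
  by rewrite kP gP (ses_comp0 sie) linear0.
have mq h k : m (q h) k = h (i k).
  have [h' hh' ->] := mP (q h); apply/eqP; rewrite -subr_eq0.
  have [|g gP] := (qP (h' - h)).1; first by rewrite linearB hh' subrr.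
  by apply/eqP; rewrite [LHS](gP (i k)) (ses_comp0 sie) linear0.
exists m; split=> //.
  apply: linear_inj0 => b; have [h <-] := qs b => mh0; apply/qP.
  have [|g gP] := ses_factor (g := h) sie; last by exists g => v; rewrite gP.
  by move=> k; rewrite -mq mh0.
move=> tA psi; have [v vP] := eV (psi \o q : {linear _ -> C}).
have [|k kP] := (ex v).1.
  apply: tA => g; rewrite -[LHS](vP (g \o e : {linear V -> C})) /=.
  rewrite (qP (g \o e : {linear V -> C})).2 ?linear0 //.
  by exists g.
by exists k => b; have [h <-] := qs b; rewrite mq kP -vP.
Qed.

(** Here A has dimension at most n+1. The induction passes from A to K, which is torsionless as a
    submodule of V; the last clause, applied to K, supplies the one additional degree of vanishing
    needed for A. *)
Lemma reduced_perfect_duality n K V A (i : {linear K -> V}) (e : {linear V -> A}) B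
    (q : {linear {linear V -> C} -> B}) D :
  ses i e -> totally_reflexive C V -> Gdim_le n K ->
  (forall j, (j < n)%N -> extv C j A) -> surjective q ->
  (forall h, q h = 0 <-> exists g : {linear A -> C}, forall v, h v = g (e v)) ->
  isomorphic (Ext n.+1 A C) D ->
  [/\ G_syzygy n.+1 D B, forall (h : {linear D -> C}) x, h x = 0,
      forall j, (j < n)%N -> extv C j D & torsionless C A -> extv C n D].
Proof.
elim: n K V A i e B q => [|n IHn] K V A i e B q sie TV dK vA qs qP isoD;
  have [m [mi mq pair]] := dual_coker_embedding sie TV qs qP;
  have /totally_reflexiveP[_ [tV eV] vV vV'] := TV; have [ii es ex] := sie.
- have [tau [taus tauP]] := Ext1_hom_coker sie (vV 0).
  have [f /bij_inj_surj[fi fs]] := isoD.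
  have /totally_reflexiveP[_ [tK eK] vK vK'] := dK.
  pose tau' : {linear {linear K -> C} -> D} := f \o tau.
  have tau'P u : tau' u = 0 <-> exists b, m b = u.
    split=> [tu|[b <-]].
      have /tauP[h hP] : tau u = 0 by apply: fi; rewrite linear0.
      by exists (q h); apply: linear_ext => k; rewrite mq.
    rewrite /tau' /= (tauP (m b)).2 ?linear0 //.
    by have [h <-] := qs b; exists h => k; rewrite mq.
  have sm : ses m tau'.
    split=> // d; have [x <-] := fs d; have [u <-] := taus x.
    by exists u.
  split=> //.
  + by exists {linear K -> C}, D, m, tau'; split=> //; exact: TR_dual.
  + move=> h x; have [_ ts _] := sm; have [u <-] := ts x.
    have [k kP] := eK (h \o tau' : {linear _ -> C}).
    rewrite [LHS](kP u) (_ : k = 0) ?linear0 //; apply: ii; rewrite linear0.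
    apply: tV => g; rewrite -[LHS](kP (g \o i : {linear K -> C})) -[LHS]/(h (tau' _)).
    by rewrite (tau'P _).2 ?linear0 //; exists (q g); apply: linear_ext => y; rewrite mq.
  + move=> /pair psiP; apply: ext1v_of_extendable sm (vK' 0) _ => psi.
    by have [k kP] := psiP psi; exists (biduality C k) => b; rewrite kP.
have [K2 [V1 [i1 [e1 [si1 TV1 dK2]]]]] := dK.
have /totally_reflexiveP[_ _ _ vV1'] := TV1.
pose q1 : {linear {linear V1 -> C} -> coker (precomp e1 C)} := quo_pi _.
have q1s : surjective q1 by move=> x; exists (repr x); exact: quo_reprK.
have q1P h : q1 h = 0 <-> exists g : {linear K -> C}, forall v, h v = g (e1 v).
  rewrite quo_pi_eq0 mem_imageP; split=> [[g <-]|[g gP]]; exists g => //.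
  by apply: linear_ext => v; rewrite gP.
have tK : torsionless C K.
  move=> k k0; apply: ii; rewrite linear0; apply: tV => h.
  exact: (k0 (h \o i : {linear K -> C})).
have [||sB1 hD0 vD vDn] := IHn _ _ _ _ _ _ q1 si1 TV1 dK2 _ q1s q1P.
- by move=> j jn; apply/(extv_shift sie (vV _) (vV _))/vA.
- exact: isomorphic_trans (Ext_shift sie (vV n) (vV n.+1)) isoD.
(* As Ext^1(A, C) = 0, every functional on K extends to V, so B is the whole dual of K and the
   kernel of [q1]. *)
have sm : ses (precomp e1 C \o m) q1.
  have [_ e1s _] := si1; split=> //.
    move=> b b' bb'; apply: mi; apply: linear_ext => k; have [v <-] := e1s k.
    exact: (congr1 (fun h : {linear _ -> _} => h v) bb').
  move=> h; rewrite q1P; split=> [[g gP]|[b <-]]; last by exists (m b).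
  have [g' g'P] := vA 0 isT _ _ _ _ sie g.
  exists (q g'); apply: linear_ext => v; rewrite gP -g'P -mq.
  by [].
split=> //.
- by exists {linear V1 -> C}, (coker (precomp e1 C)), (precomp e1 C \o m), q1;
    split=> //; exact: TR_dual.
- move=> j; rewrite ltnS leq_eqVlt => /orP[/eqP->|]; last exact: vD.
  exact: vDn.
- move=> /pair psiP; rewrite -[n.+1]addn0; apply/(G_syzygy_extv _ sB1).
  apply: ext1v_of_extendable sm (vV1' 0) _ => psi.
  have [k kP] := psiP psi; have [_ e1s _] := si1; have [w we] := e1s k.
  by exists (biduality C w) => b; rewrite kP -we.
Qed.

Lemma Gdim_le_totally_reflexive n M :
  Gdim_le n M -> (forall j, extv C j M) -> totally_reflexive C M.
Proof.
elim: n M => // n IHn M [K [V [i [e [sie TV dK]]]]] vM.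
have /totally_reflexiveP[_ _ vV _] := TV.
apply: (totally_reflexive_ses_right R_noetherian C_semidualizing sie _ TV (vM 0)).
by apply: IHn dK _ => j; exact: extv_ses_left sie (vV j) (vM j.+1).
Qed.

Lemma Gdim_le_is_zero n M : Gdim_le n M -> (forall j, extv C j M) ->
  (forall (h : {linear M -> C}) x, h x = 0) -> is_zero M.
Proof.
move=> dM vM h0 x.
have /totally_reflexiveP[_ [tM _] _ _] := Gdim_le_totally_reflexive dM vM.
by apply: tM => h; exact: h0.
Qed.

Lemma has_G_resolutionP n M : has_G_resolution C M n <-> Gdim_le n M.
Proof.
split.
  move=> [X [d [e [es ex exd TX X0]]]]; move: X d e es ex exd TX X0.
  elim: n M => [|n IHn] M X d e es ex exd TX X0.
    apply: (totally_reflexive_iso R_noetherian _ (TX 0 (leqnn _))).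
    exists e; apply/bij_inj_surj; split=> //; apply: linear_inj0 => x /ex[y <-].
    by rewrite (X0 1%N isT y) linear0.
  have sk := ses_kernel es; have [ki _ kx] := sk.
  have [|d0 d0P] := ses_lift (g := d 0) sk.
    by move=> x; apply/ex; exists x.
  exists (submod (kernel e)), (X 0), (ker_incl e), e; split=> //; first exact: TX.
  apply: (IHn _ (fun j => X j.+1) (fun j => d j.+1) d0) => //.
  - move=> k; have [x xk] := (ex (ker_incl e k)).1 (ses_comp0 sk k).
    by exists x; apply: ki; rewrite d0P.
  - move=> y; rewrite -(exd 0); split=> [y0|y0]; last by apply: ki; rewrite d0P y0 linear0.
    by rewrite -d0P y0 linear0.
  - by move=> j; exact: (TX j.+1).
  - by move=> j; exact: (X0 j.+1).
elim: n M => [|n IHn] M.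
  move=> TM.
  exists (fun j => if j is _.+1 then zero_mod M else M).
  exists (fun j => \0), idfun; split=> [x|x|[|j] x|[|j]|[|j]] //; first by exists x.
  - split=> [xM|[y <-]]; last by [].
    by exists 0; rewrite linear0 -xM.
  - split=> _; first by exists 0; rewrite linear0 [RHS]zero_modP.
    by [].
  - split=> _; first by exists 0; rewrite linear0 [RHS]zero_modP.
    by [].
  - by move=> _; exact: zero_modP.
move=> [K [V [i [e [sie TV /IHn[X [d [f [fs fx dx TX X0]]]]]]]]].
have [ii es ex] := sie.
pose X' j := if j is k.+1 then X k else V.
pose d' j : {linear X' j.+1 -> X' j} :=
  match j return {linear X' j.+1 -> X' j} with
  | 0 => i \o f
  | k.+1 => d k
  end.
exists X', d', e; split=> //.
- move=> v; rewrite (ex v); split=> [[k <-]|[x <-]]; last by exists (f x).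
  by have [x <-] := fs k; exists x.
- case=> [|j] x; last exact: dx.
  rewrite -(fx x); split=> [ifx|/= ->]; last exact: linear0.
  by apply: ii; rewrite linear0.
- by case=> [|j] //; exact: TX.
- by case=> [|j] //; exact: X0.
Qed.

End GDimension.

(** * A prime annihilator in a nonzero module over a Noetherian ring *)

Section AssociatedPrime.
Variables (R : comNzRingType) (Y : lmodType R).

Definition eventual_annihilator (y : nat -> Y) : {pred R^o} :=
  fun a => `[< exists n, forall m, (n <= m)%N -> (a : R) *: y m = 0 >].

Lemma eventual_annihilator_closed y : submod_closed (eventual_annihilator y).
Proof.
split=> [|a x z]; rewrite !unfold_in; first by apply/asboolP; exists 0 => m _; rewrite scale0r.
move=> /asboolP[n nP] /asboolP[k kP]; apply/asboolP; exists (maxn n k) => m.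
rewrite geq_max => /andP[nm km].
by rewrite scalerDl -scalerA nP // kP // scaler0 addr0.
Qed.
HB.instance Definition _ y :=
  GRing.isSubmodClosed.Build R R^o (eventual_annihilator y)
    (eventual_annihilator_closed y).

(** Otherwise dependent choice gives a sequence of multiples of one element whose annihilators
    increase strictly, while their union is finitely generated. *)
Lemma exists_prime_annihilator : noetherian R -> ~ is_zero Y ->
  exists y : Y, y <> 0 /\
    forall a b : R, (a * b) *: y = 0 -> a *: y = 0 \/ b *: y = 0.
Proof.
move=> nR /existsNP[y0 y0_neq0]; apply: contrapT => noP.
have step (y : {y : Y | y <> 0}) : exists y' : {y : Y | y <> 0},
    exists a b : R, [/\ sval y' = a *: sval y, b *: sval y <> 0 & b *: sval y' = 0].
  apply: contrapT => noS; apply: noP; exists (sval y); split; first exact: (proj2_sig y).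
  move=> a b ab0; have [a0|a0] := pselect (a *: sval y = 0); first by left.
  right; apply: contrapT => b0; apply: noS.
  exists (exist _ (a *: sval y) a0), a, b; split=> //=.
  by rewrite scalerA mulrC.
have [s sP] := choice step.
pose w n := sval (iter n s (exist _ y0 y0_neq0)).
have wS n : exists a : R, w n.+1 = a *: w n.
  by have [a [b []]] := sP (iter n s (exist _ y0 y0_neq0)); exists a.
have w_mono (a : R) n m : (n <= m)%N -> a *: w n = 0 -> a *: w m = 0.
  move=> /subnK <- an; elim: (m - n)%N => // k IHk.
  by have [b] := wS (k + n)%N; rewrite -addSn => ->; rewrite scalerA mulrC -scalerA IHk scaler0.
have [k [g gP]] := nR (eventual_annihilator w).
have gN (i : 'I_k) : exists N, forall m, (N <= m)%N -> (val (g i) : R) *: w m = 0.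
  by have /asboolP := valP (g i).
(* By stage [M] all generators of the union kill the sequence, hence so does [b], which was chosen
   not to kill the term of index [M]. *)
have [N NP] := choice gN; pose M := \max_i N i.
have [a [b [_ bM bSM]]] := sP (iter M s (exist _ y0 y0_neq0)).
apply: bM; have bI : b \in eventual_annihilator w.
  by apply/asboolP; exists M.+1 => m Mm; exact: w_mono Mm bSM.
have [c cP] := gP (Submod bI).
have -> : b = \sum_i c i * (val (g i) : R).
  pose v : {linear submod (eventual_annihilator w) -> R^o} := val.
  by have /(congr1 v) := cP; rewrite linear_sum.
rewrite scaler_suml; apply: big1 => i _; rewrite -scalerA NP ?scaler0 //.
exact: (leq_bigmax i).
Qed.

End AssociatedPrime.

(** * Nonzero maps from a finite faithful module to any nonzero module *)

Section HomNonzero.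
Variables (R : comNzRingType) (C : lmodType R).

Section Prime.
Variables (p : R -> Prop).
Hypotheses (pD : forall a b, p a -> p b -> p (a + b))
  (pM : forall a b, p b -> p (a * b)) (p_prime : forall a b, p (a * b) -> p a \/ p b).

(** Nakayama's lemma at p with denominators cleared: [s] is invertible at p and maps the generators
    into p times their span. The last generator is eliminated by means of the multiplier s - b_max,
    which is outside p as well. *)
Lemma nakayama_prime (m : nat) (c : 'I_m -> C) (s : R) : ~ p s ->
  (forall j, exists b : 'I_m -> R, (forall k, p (b k)) /\ s *: c j = \sum_k b k *: c k) ->
  exists s', ~ p s' /\ forall j, s' *: c j = 0.
Proof.
elim: m c s => [|m IHm] c s ps sc; first by exists s; split=> // -[].
have [b [pb bP]] := sc ord_max; pose u := s - b ord_max.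
pose c' k := c (widen_ord (leqnSn m) k).
have pu : ~ p u by move=> pu; apply: ps; rewrite -(subrK (b ord_max) s); exact: pD.
have uc : u *: c ord_max = \sum_k b (widen_ord (leqnSn m) k) *: c' k.
  by rewrite scalerBl bP big_ord_recr /= addrK.
have [||s' [ps' s'P]] := IHm c' (u * s).
- by move=> /p_prime[].
- move=> j; have [d [pd dP]] := sc (widen_ord (leqnSn m) j).
  exists (fun k => u * d (widen_ord (leqnSn m) k) + b (widen_ord (leqnSn m) k) * d ord_max).
  split=> [k|]; first by apply: pD; exact: pM.
  rewrite -scalerA dP big_ord_recr /= scalerDr scaler_sumr scalerA mulrC -scalerA uc.
  rewrite scaler_sumr -big_split /=; apply: eq_bigr => k _.
  by rewrite scalerDl !scalerA [d ord_max * _]mulrC.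
exists (u * s'); split=> [/p_prime[]//|j].
have [k ->|->] := unliftP ord_max j.
  rewrite (_ : fintype.lift ord_max k = widen_ord (leqnSn m) k); last first.
    by apply: val_inj; rewrite /= /bump leqNgt ltn_ord.
  by rewrite -scalerA [s' *: _]s'P scaler0.
rewrite mulrC -scalerA uc scaler_sumr; apply: big1 => k _.
by rewrite scalerA mulrC -scalerA s'P scaler0.
Qed.

End Prime.

(** For y with prime annihilator p, a nonzero map from C to R y is built from a coordinate on a
    one-dimensional quotient of C at p. *)
Lemma hom_eq0_is_zero (Y : lmodType R) :
  noetherian R -> fin_gen C -> (forall a : R, (forall c : C, a *: c = 0) -> a = 0) ->
  (forall (phi : {linear C -> Y}) c, phi c = 0) -> is_zero Y.
Proof.
move=> nR [m [c cP]] C_faith phi0; apply: contrapT.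
move=> /(exists_prime_annihilator nR)[y [y_neq0 y_prime]].
pose p (a : R) := a *: y = 0.
have p0 : p 0 by exact: scale0r.
have pD a b : p a -> p b -> p (a + b) by rewrite /p scalerDl => -> ->; rewrite addr0.
have pM a b : p b -> p (a * b) by rewrite /p -scalerA => ->; rewrite scaler0.
pose N j x := exists a : 'I_m -> R,
  (forall k : 'I_m, (j <= k)%N -> p (a k)) /\ x = \sum_k a k *: c k.
(* At p, this says that C is spanned modulo p C by the first j generators. It holds for j = m and
   fails for j = 0 by Nakayama and faithfulness; at the j where it changes, the quotient by p C and
   the first j generators is a line spanned by the generator of index j. *)
pose Q j := exists s, ~ p s /\ forall x, N j (s *: x).
have Qm : Q m.
  exists 1; split=> [|x]; first by rewrite /p scale1r.
  have [a ->] := cP x; exists a; split=> [k|]; last by rewrite scale1r.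
  by rewrite leqNgt ltn_ord.
have Q0 : ~ Q 0%N.
  move=> [s [ps sN]].
  have [|s' [ps' s'P]] := nakayama_prime pD pM y_prime ps (c := c).
    by move=> j; have [a [pa aP]] := sN (c j); exists a; split=> // k; exact: pa.
  apply: ps'; rewrite (C_faith s') // => x; have [a ->] := cP x.
  rewrite scaler_sumr; apply: big1 => k _.
  by rewrite scalerA mulrC -scalerA s'P scaler0.
have [j jm [nQj Qj]] : exists2 j, (j < m)%N & ~ Q j /\ Q j.+1.
  apply: contrapT => noj; suff : forall k, (k <= m)%N -> ~ Q k by move/(_ m (leqnn m)).
  elim=> // k IHk km Qk; apply: noj; exists k => //; split=> //.
  exact/IHk/ltnW.
have [s [ps sN]] := Qj; pose l := Ordinal jm.
pose r x z := exists a : 'I_m -> R,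
  [/\ forall k : 'I_m, (j < k)%N -> p (a k), s *: x = \sum_k a k *: c k & z = a l *: y].
(* The coordinate is well defined: a relation whose coefficient at [l] is outside p would eliminate
   that generator and give [Q j]. *)
have r0 z : r 0 z -> z = 0.
  move=> [a [pa a0 ->]]; apply: contrapT => pal; apply: nQj.
  exists (a l * s); split=> [/y_prime[]//|x].
  have [d [pd dP]] := sN x; exists (fun k => a l * d k - d l * a k); split=> [k|].
    rewrite leq_eqVlt => /orP[/eqP jk|jk].
      by rewrite (_ : k = l) ?[d l * _]mulrC ?subrr //; apply: val_inj.
    by rewrite -mulNr; apply: pD; apply: pM; [exact: pd|exact: pa].
  rewrite -scalerA dP; apply/eqP; rewrite -subr_eq0.
  rewrite scaler_sumr -sumrB; apply/eqP; transitivity (d l *: \sum_k a k *: c k).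
    rewrite scaler_sumr; apply: eq_bigr => k _.
    by rewrite scalerBl opprB !scalerA addrC subrK.
  by rewrite -a0 !scaler0.
have [||//|phi phiP] := @linear_choice R C Y r.
- by move=> x; have [a [pa aP]] := sN x; exists (a l *: y), a; split.
- move=> e x x' z z' [a [pa aP ->]] [b [pb bP ->]].
  exists (fun k => e * a k + b k); split=> [k jk||].
  + by apply: pD; [apply: pM; exact: pa|exact: pb].
  + rewrite scalerDr scalerA mulrC -scalerA aP bP scaler_sumr -big_split /=.
    by apply: eq_bigr => k _; rewrite scalerDl scalerA.
  + by rewrite scalerDl scalerA.
have [a [pa aP phil]] := phiP (c l).
(* The map sends the generator of index [l] to s y, which is nonzero as [s] is outside p. *)
have : s *: y - a l *: y = 0.
  apply: r0; exists (fun k => (if k == l then s else 0) - a k); split=> [k jk||].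
  + rewrite (_ : k == l = false); last by apply/eqP => kl; rewrite kl ltnn in jk.
    by rewrite sub0r -mulN1r; apply: pM; exact: pa.
  + rewrite scaler0; apply/esym; transitivity (s *: c l - \sum_k a k *: c k); last first.
      by rewrite -aP subrr.
    rewrite (bigD1 l) //= eqxx [in RHS](bigD1 l) //= scalerBl opprD addrA; congr (_ + _).
    rewrite -sumrN; apply: eq_bigr => k /negPf ->.
    by rewrite sub0r scaleNr.
  + by rewrite eqxx scalerBl.
by rewrite -phil phi0 subr0; exact: ps.
Qed.

End HomNonzero.

(** * Vanishing of Ext in the second variable *)

Section ExtSecondVariable.
Variables (R : comNzRingType).
Implicit Types A B D H K U V W X Z P N F : lmodType R.

Lemma hom_swap U V N (h : {linear U -> {linear V -> N}}) :
  exists h' : {linear V -> {linear U -> N}}, forall u v, h' v u = h u v.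
Proof.
have [||f|h' h'P] := @linear_choice R V {linear U -> N} (fun v f => forall u, f u = h u v).
- move=> v; have lin : linear (fun u => h u v) by move=> a x y; rewrite linearP.
  by exists (mk_linear lin).
- by move=> a x y x' y' xx yy u; rewrite /= xx yy linearP.
- by move=> f0; apply: linear_ext => u; rewrite f0 linear0.
by exists h'.
Qed.

(** Swapping arguments turns the extension problem into lifting a map from P along Hom(V, N) ->
    Hom(K, N). This also covers the free modules on underlying sets, which may have infinite
    rank. *)
Lemma ext1v_hom_projective N X P :
  projective P -> ext1v N X -> ext1v {linear P -> N} X.
Proof.
move=> projP vX K V i e sie h.
have [h' h'P] := hom_swap h.
have surj : surjective (precomp i N).
  by move=> u; have [v vP] := vX _ _ _ _ sie u; exists v; exact: linear_ext.
have [g gP] := projective_lift h' projP surj.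
have [g' g'P] := hom_swap g; exists g' => k; apply: linear_ext => x.
by rewrite g'P -h'P -gP.
Qed.

Lemma ext1v_lift N' N N'' X (i : {linear N' -> N}) (e : {linear N -> N''})
    (h : {linear X -> N''}) :
  ses i e -> ext1v N' X -> exists g : {linear X -> N}, forall x, e (g x) = h x.
Proof.
move=> sie vX.
have [W [j [p [q [sjq epq pj _ _]]]]] := ses_pullback h sie.
have [ret retP] := vX _ _ _ _ sjq idfun.
have [|g gP] := ses_factor (g := idfun \- (j \o ret) : {linear W -> W}) sjq.
  by move=> k /=; rewrite retP subrr.
exists (p \o g : {linear X -> N}) => x; have [_ qs _] := sjq; have [w <-] := qs x.
by rewrite /= epq gP /= linearB (ses_comp0 sjq) subr0.
Qed.

(** The hypothesis on [Omega X] is Ext^2(X, N') = 0. *)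
Lemma ext1v_ses_second N' N N'' X (i : {linear N' -> N}) (e : {linear N -> N''}) :
  ses i e -> ext1v N X -> ext1v N' (Omega X) -> ext1v N'' X.
Proof.
move=> sie vX vO; apply: ext1v_of_extendable (ses_Omega X) _ _.
  exact/ext1v_projective/free_on_projective.
move=> h; have [g gP] := ext1v_lift h sie vO.
have [g' g'P] := vX _ _ _ _ (ses_Omega X) g.
by exists (e \o g' : {linear _ -> N''}) => k; rewrite /= g'P gP.
Qed.

End ExtSecondVariable.

(** * Comparison of grades with respect to R and to C *)

Section Grade.
Variables (R : comNzRingType) (C : lmodType R).
Variables (R_noetherian : noetherian R) (C_semidualizing : semidualizing C).
Implicit Types A B D E H K U V W X Z P N F : lmodType R.

(** Below the grade, the dual sequences of the canonical resolution are exact and Ext(C, -) vanishes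
    on duals of free modules. Each step lowers k and raises the Ext degree, down to the dual of E,
    which is zero. *)
Lemma extv_syzygy_dual E k j :
  (forall (h : {linear E -> C}) x, h x = 0) -> (forall l, (l < k)%N -> extv C l E) ->
  extv {linear syzygy E k -> C} j C.
Proof.
move=> h0; elim: k j => [|k IHk] j vE.
  move=> K V i e sie h; exists \0 => x /=.
  by apply: linear_ext => y; rewrite [RHS]h0.
have sd := dual_ses (ses_Omega (syzygy E k)) (vE k (leqnn _)).
apply: ext1v_ses_second sd _ _.
  apply: ext1v_hom_projective; first exact: free_on_projective.
  exact: (extv_C C_semidualizing (j := j)).
by apply: (IHk j.+1) => l lk; exact/vE/ltnW.
Qed.

(** Exchanging arguments gives a map from U to Hom(C, C) = R. *)
Lemma hom_to_endo U (A : {linear C -> {linear U -> C}}) :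
  exists chi : {linear U -> R^o}, forall c u, A c u = (chi u : R) *: c.
Proof.
have [A' A'P] := hom_swap A.
have [||y|chi chiP] := @linear_choice R U R^o (fun u r => forall c, A c u = (r : R) *: c).
- by move=> u; have [a aP] := C_endo C_semidualizing (A' u); exists a => c; rewrite -A'P aP.
- move=> a x y x' y' xx yy c.
  by rewrite linearP xx yy scalerDl scalerA.
- by move=> y0; apply: (C_faithful C_semidualizing) => c; rewrite -y0 linear0.
by exists chi.
Qed.

Lemma extv_regularP E k :
  (forall (h : {linear E -> C}) x, h x = 0) -> (forall l, (l < k)%N -> extv C l E) ->
  extv R^o k E <-> extv C k E.
Proof.
move=> h0 vE; set D := syzygy E k.
have vZ j := @extv_syzygy_dual E k j h0 vE; rewrite -/D in vZ.
have projF : projective (free_on D) := @free_on_projective _ D.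
split=> [vR|vC].
  apply/Ext_eq0; have [tau [taus tauP]] := Ext_hom_coker C E k.
  apply: (hom_eq0_is_zero (C := C) R_noetherian).
  - exact: fin_gen_C.
  - by move=> a; exact: (C_faithful C_semidualizing).
  move=> phi c; have st := ses_kernel taus.
  have [|l lP] := ses_lift (g := precomp (Omega_incl D) C) st.
    by move=> h; apply/tauP; exists h.
  have sl : ses (precomp (augmentation D) C) l.
    have [augi _ _] := ses_Omega D; have [kti ktx _] := st; split.
    - move=> f g fg; apply: linear_ext => x; have [y <-] := augmentation_surj x.
      exact: (congr1 (fun u : {linear _ -> _} => u y) fg).
    - move=> b; have /tauP[g gP] := ses_comp0 st b; exists g; apply: kti.
      by rewrite lP; exact: linear_ext.
    - move=> h; split=> [lh|[g <-]].
        have [|g gP] := ses_factor (g := h) (ses_Omega D).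
          move=> k'; have := lP h; rewrite lh linear0.
          move=> /(congr1 (fun u : {linear _ -> _} => u k')).
          by move/esym.
        by exists g; exact: linear_ext.
      apply: kti; rewrite lP linear0; apply: linear_ext => x /=.
      by rewrite [augmentation D _](ses_comp0 (ses_Omega D)) linear0.
  (* Ext^1 from C into the coboundaries vanishes, so [phi] lifts to cocycles. The lift amounts to a
     functional to R, which extends by hypothesis; the lifted values are therefore coboundaries and
     [phi] is zero. *)
  have vB : ext1v (submod (kernel tau)) C.
    apply: ext1v_ses_second sl _ (vZ 1%N).
    exact: ext1v_hom_projective projF (extv_C C_semidualizing (j := 0)).
  have [phi' phi'P] := ext1v_lift phi st vB.
  have [chi chiP] := hom_to_endo phi'.
  have [chi' chi'P] := vR _ _ _ _ (ses_Omega D) chi.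
  rewrite -phi'P; apply/tauP.
  have [g gP] := functional_linear chi' c.
  by exists g => x; rewrite gP chi'P chiP.
apply: ext1v_of_extendable (ses_Omega D) (ext1v_projective projF) _ => chi.
(* Conversely, multiplication by [chi] maps C to the dual of the syzygy; lifting it to the dual of
   the free module and returning to R yields the extension of [chi]. *)
have [a aP] := functional_hom_linear C chi.
have sd := dual_ses (ses_Omega D) vC.
have [A AP] := ext1v_lift a sd (vZ 0%N).
have [r rP] := hom_to_endo A; exists r => x.
apply/eqP; rewrite -subr_eq0; apply/eqP.
apply: (C_faithful C_semidualizing) => c.
by rewrite scalerBl -rP -aP -AP subrr.
Qed.

Lemma hom_regular_eq0P E :
  (forall (h : {linear E -> R^o}) x, h x = 0) <-> (forall (h : {linear E -> C}) x, h x = 0).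
Proof.
split=> h0.
  suff E0 : is_zero {linear E -> C} by move=> h x; rewrite (E0 h).
  apply: (hom_eq0_is_zero (C := C) R_noetherian).
  - exact: fin_gen_C.
  - by move=> a; exact: (C_faithful C_semidualizing).
  move=> phi c; have [chi chiP] := hom_to_endo phi.
  by apply: linear_ext => x; rewrite chiP h0 scale0r.
move=> h x; apply: (C_faithful C_semidualizing) => c.
by have [g gP] := functional_linear h c; rewrite -gP h0.
Qed.

Lemma Ext_regularP E i : (forall j, (j < i)%N -> is_zero (Ext j E C)) ->
  is_zero (Ext i E R^o) <-> is_zero (Ext i E C).
Proof.
case: i => [|i] E0; first by rewrite !Ext0_eq0; exact: hom_regular_eq0P.
rewrite !Ext_eq0; apply: extv_regularP; first exact/Ext0_eq0/(E0 0%N).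
by move=> l li; exact/Ext_eq0/(E0 l.+1).
Qed.

Lemma inf_natP (P : nat -> Prop) n :
  inf_nat P = Some n <-> P n /\ forall m, (m < n)%N -> ~ P m.
Proof.
rewrite /inf_nat; case: pselect => [exP|noP]; last first.
  by split=> // -[Pn _]; case: noP; exists n; exact/asboolP.
case: ex_minnP => k /asboolP Pk kmin; split=> [[<-]|[Pn nmin]].
  by split=> // m mk Pm; have := kmin m (asboolT Pm); rewrite leqNgt mk.
congr Some; apply/eqP; rewrite eqn_leq kmin ?asboolT //=.
by rewrite leqNgt; apply/negP => /nmin.
Qed.

Lemma inf_nat_eq (P Q : nat -> Prop) :
  (forall i, (forall j, (j < i)%N -> ~ P j) -> P i <-> Q i) -> inf_nat P = inf_nat Q.
Proof.
move=> PQ; case EP: (inf_nat P) => [n|].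
  apply/esym/inf_natP; have [Pn Pm] := (inf_natP P n).1 EP.
  split=> [|m mn Qm]; first exact/(PQ n Pm).
  by apply: (Pm m mn); apply/PQ => // j jm; apply: Pm; exact: ltn_trans mn.
case EQ: (inf_nat Q) => [n|] //.
have noP i : ~ P i.
  move=> Pi; move: EP; rewrite /inf_nat; case: pselect => // noP.
  by case: noP; exists i; exact/asboolP.
by have [Qn _] := (inf_natP Q n).1 EQ; case: (noP n); apply/PQ.
Qed.

Lemma gradeE E : grade E = inf_nat (fun i => ~ is_zero (Ext i E C)).
Proof.
apply/esym/inf_nat_eq => i iP.
have E0 j : (j < i)%N -> is_zero (Ext j E C) by move=> /iP/contrapT.
by have := Ext_regularP E0 => EP; split=> nE /EP.
Qed.

End Grade.

(** * The symmetric implication *)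

Section PerfectDuality.
Variables (R : comNzRingType) (C : lmodType R).
Variables (R_noetherian : noetherian R) (C_semidualizing : semidualizing C).
Implicit Types A B D E K V : lmodType R.

Lemma G_dim_eq n M : Gdim_le C n.+1 M -> ~ extv C n M -> G_dim C M = Some n.+1.
Proof.
move=> dM nvM; apply/inf_natP; split; first exact/(has_G_resolutionP C R_noetherian).
move=> m; rewrite ltnS => mn /(has_G_resolutionP C R_noetherian) dm.
by apply: nvM; exact: Gdim_le_extv dm mn.
Qed.

Lemma linked_reduced_perfect A B V (e : {linear V -> A})
    (q : {linear {linear V -> C} -> B}) (n t : nat) :
  totally_reflexive C V -> surjective e -> surjective q ->
  (forall h, q h = 0 <-> exists g : {linear A -> C}, forall v, h v = g (e v)) ->
  (0 < n)%N -> (0 < t)%N ->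
  [/\ reduced_G_perfect C A, G_dim C A = Some n,
      G_perfect C (Ext n A C) & G_dim C (Ext n A C) = Some (n + t)%N] ->
  [/\ reduced_G_perfect C B, G_dim C B = Some t,
      G_perfect C (Ext t B C) & G_dim C (Ext t B C) = Some (n + t)%N].
Proof.
case: n => // n; case: t => // t TV es qs qP _ _.
move=> [[_ _ rA] dA [_ _ gE] dE]; set E := Ext n.+1 A C in gE dE.
rewrite dA in rA; rewrite dE (gradeE R_noetherian C_semidualizing) addnS in gE.
(* The common dimension is g + 1, in line with [extv C g] being about Ext in degree g + 1. *)
have [g defg] : exists g, g = (n.+1 + t)%N by exists (n.+1 + t)%N.
rewrite addnS in dE *; rewrite -defg in gE dE *.
have {dA}/inf_natP[/(has_G_resolutionP C R_noetherian) dA _] := dA.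
have {rA}/inf_natP[_ rA] := rA.
have {dE}/inf_natP[/(has_G_resolutionP C R_noetherian) dE _] := dE.
have {gE}/inf_natP[nE E0] := gE.
have vA j : (j < n)%N -> extv C j A.
  move=> jn; apply/Ext_eq0; apply: contrapT => nA.
  by apply: (rA j.+1); rewrite ?ltnS.
have sk := ses_kernel es.
have [sB _ _ _] := reduced_perfect_duality R_noetherian C_semidualizing sk TV
  (Gdim_le_kernel R_noetherian C_semidualizing sk TV dA) vA qs qP (isomorphic_refl E).
have vE j : (j < g)%N -> extv C j E.
  by move=> jg; apply/Ext_eq0; apply: contrapT; apply: E0; rewrite ltnS.
have nvE : ~ extv C g E by move=> /Ext_eq0.
have dB : Gdim_le C t.+1 B.
  by apply: (G_syzygy_Gdim_le R_noetherian C_semidualizing sB); rewrite addnS -defg.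
have nvB : ~ extv C t B by move=> /(G_syzygy_extv _ sB); rewrite -defg.
have vB j : (j < t)%N -> extv C j B.
  by move=> jt; apply/(G_syzygy_extv _ sB)/vE; rewrite defg ltn_add2l.
set E' := Ext t.+1 B C.
have isoE' : isomorphic (Ext g.+1 E C) E'.
  by apply: isomorphic_sym; rewrite defg; exact: G_syzygy_Ext sB.
have [K [V' [i' [e' [sie' TV' dK]]]]] := dE.
(* The duality for E itself. Since Hom(E, C) = 0, the cokernel of the dual map is the whole dual of
   V', hence q = id, and E' has a totally reflexive module as its syzygy of index g + 1. *)
have [||sE' hE' vE' _] := reduced_perfect_duality R_noetherian C_semidualizing
  sie' TV' dK vE (q := idfun) _ _ isoE'.
- by move=> h; exists h.
- have hE0 (h : {linear E -> C}) x : h x = 0.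
    by have /Ext0_eq0 : is_zero (Ext 0 E C) by apply: contrapT; apply: E0.
  move=> h; change (h = 0 <-> exists g0 : {linear E -> C}, forall v, h v = g0 (e' v)).
  split=> [->|[k kP]]; first by exists \0.
  by apply: linear_ext => v; rewrite [LHS]kP hE0.
have dE' : Gdim_le C g.+1 E'.
  rewrite -[g.+1]addn0; apply: Gdim_le_of_G_syzygy sE' _.
  exact: totally_reflexive_dual.
(* If the top Ext vanished as well, E' would have no Hom or Ext into C at all and would be zero. *)
have nvE' : ~ extv C g E'.
  move=> vE'g; apply: nvB; apply/Ext_eq0.
  apply: (Gdim_le_is_zero R_noetherian C_semidualizing dE' _ hE') => j.
  have [jg|jg|->] := ltngtP j g; [exact: vE'| exact: Gdim_le_extv dE' jg | exact: vE'g].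
have GB := G_dim_eq dB nvB; have GE' := G_dim_eq dE' nvE'.
split=> //; split; rewrite ?GB ?GE' //; try exact: Gdim_le_fin_gen dB;
  try exact: Gdim_le_fin_gen dE'.
  apply/inf_natP; split; first by split=> // /Ext_eq0.
  by case=> [|m] mt [] // _; case; apply/Ext_eq0/vB; rewrite -ltnS.
rewrite (gradeE R_noetherian C_semidualizing); apply/inf_natP.
split; first by move=> /Ext_eq0.
by case=> [|m] mg; case; [apply/Ext0_eq0 | apply/Ext_eq0/vE'; rewrite -ltnS].
Qed.

End PerfectDuality.

(** * Tensor products and the effect of a vanishing Tor *)

Section TensorMaps.
Variables (R : comNzRingType).
Implicit Types K L M N P T U V W : lmodType R.

Definition tens M N (m : M) (n : N) : tensor M N := quo_pi _ << (m, n) >>.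

Lemma mem_span V (G : V -> Prop) x : G x -> x \in Defs.span G.
Proof. by move=> Gx; apply/asboolP => S; exact. Qed.

Lemma tens_sumr M N I (r : seq I) (m : M) (F : I -> N) :
  tens m (\sum_(i <- r) F i) = \sum_(i <- r) tens m (F i).
Proof.
have tensD n n' : tens m (n + n') = tens m n + tens m n'.
  rewrite /tens -linearD; apply/quo_piP; rewrite opprD addrA.
  exact/mem_span/(TensorDr m n n').
have tens0 : tens m (0 : N) = 0.
  by apply: (addrI (tens m 0)); rewrite -tensD !addr0.
by elim: r => [|i r IHr]; rewrite ?big_nil // !big_cons tensD IHr.
Qed.

Lemma tens_suml M N I (r : seq I) (F : I -> M) (n : N) :
  tens (\sum_(i <- r) F i) n = \sum_(i <- r) tens (F i) n.
Proof.
have tensD m m' : tens (m + m') n = tens m n + tens m' n.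
  rewrite /tens -linearD; apply/quo_piP; rewrite opprD addrA.
  exact/mem_span/(TensorDl m m' n).
have tens0 : tens (0 : M) n = 0.
  by apply: (addrI (tens 0 n)); rewrite -tensD !addr0.
by elim: r => [|i r IHr]; rewrite ?big_nil // !big_cons tensD IHr.
Qed.

Lemma tensZr M N a (m : M) (n : N) : tens m (a *: n) = a *: tens m n.
Proof.
rewrite /tens -linearZ; apply/quo_piP.
exact/mem_span/(TensorZr a m n).
Qed.

Lemma tensZl M N a (m : M) (n : N) : tens (a *: m) n = a *: tens m n.
Proof.
rewrite /tens -linearZ; apply/quo_piP.
exact/mem_span/(TensorZl a m n).
Qed.

Lemma tensor_ind M N (Q : tensor M N -> Prop) :
  Q 0 -> (forall a x y, Q x -> Q y -> Q (a *: x + y)) ->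
  (forall m n, Q (tens m n)) -> forall z, Q z.
Proof.
move=> Q0 QD Qt z; rewrite -[z]quo_reprK -(freeg_sumE (repr z)) linear_sum.
elim: (dom _) => [|[m n] r IHr]; first by rewrite big_nil.
rewrite big_cons.
have -> : << coeff (m, n) (repr z) *g (m, n) >> =
    coeff (m, n) (repr z) *: << (m, n) >> :> {freeg (M * N) / R}.
  by apply/eqP/freeg_eqP => y; rewrite coeffZ !coeffU mul1r.
rewrite linearZ; apply: QD; [exact: (Qt m n)|exact: IHr].
Qed.

Lemma tensor_linear_ext M N W (f g : {linear tensor M N -> W}) :
  (forall m n, f (tens m n) = g (tens m n)) -> f =1 g.
Proof.
move=> fg; apply: tensor_ind => [|a x y xx yy|m n]; last exact: fg.
  by rewrite !linear0.
by rewrite !linearP xx yy.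
Qed.

Lemma tensor_map_tens M M' N (f : {linear M -> M'}) m (n : N) :
  tensor_map f N (tens m n) = tens (f m) n.
Proof.
by rewrite /tensor_map /tens /= tensor_map_funE /tensor_free /= liftU scale1r.
Qed.

Lemma tensor_map_surj M M' N (f : {linear M -> M'}) :
  surjective f -> surjective (tensor_map f N).
Proof.
move=> fs; apply: tensor_ind => [|a _ _ [x <-] [y <-]|m n].
- by exists 0; rewrite linear0.
- by exists (a *: x + y); rewrite linearP.
- by have [x <-] := fs m; exists (tens x n); rewrite tensor_map_tens.
Qed.

Lemma functional_tensor_linear M N (lam : {linear M -> R^o}) :
  exists f : {linear tensor M N -> N}, forall m n, f (tens m n) = (lam m : R) *: n.
Proof.
pose G : {linear {freeg (M * N) / R} -> N} :=
  fglift (fun mn : M * N => (lam mn.1 : R) *: mn.2).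
have GU (mn : M * N) : G << mn >> = (lam mn.1 : R) *: mn.2.
  by rewrite /G /= liftU scale1r.
have Gspan x : x \in Defs.span (@bilinear_relation R M N) -> G x = 0.
  move=> /asboolP /(_ (kernel G)) H; apply/eqP; apply: H => y [] *; rewrite kernelE.
  - by rewrite !linearB !GU [lam _]linearD scalerDl -addrA -opprD subrr.
  - by rewrite !linearB !GU scalerDr -addrA -opprD subrr.
  - by rewrite linearB linearZ_LR !GU /= [lam _]linearZ_LR scalerA subrr.
  - by rewrite linearB linearZ_LR !GU /= !scalerA mulrC subrr.
have [||y|f fP] := @linear_choice R (tensor M N) N
  (fun z y => exists2 x, quo_pi _ x = z & G x = y).
- by move=> z; exists (G (repr z)), (repr z) => //; exact: quo_reprK.
- by move=> a _ _ _ _ [x <- <-] [y <- <-]; exists (a *: x + y); rewrite linearP.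
- by move=> [x /quo_pi_eq0/Gspan-> <-].
exists f => m n; have [x xE <-] := fP (tens m n).
apply/eqP; rewrite -[_ *: n](GU (m, n)) -subr_eq0 -linearB; apply/eqP/Gspan/quo_piP.
exact: xE.
Qed.

(** For the canonical presentation this is the definition of Tor; a homotopy between the two
    presentations carries it over. *)
Lemma Tor1_tensor_injective K P T N (i : {linear K -> P}) (e : {linear P -> T}) :
  ses i e -> projective P -> is_zero (Tor 1 T N) -> injective (tensor_map i N).
Proof.
move=> sie projP Tor0; have [ii es ex] := sie.
have so := ses_Omega T; have [oi augs _] := so.
have omN0 z : tensor_map (Omega_incl T) N z = 0 -> z = 0.
  move=> z0; have [y yz] := @tensor_map_surj _ _ N _ (@augmentation_surj R (Omega T)) z.
  have dy : tensor_map (free_diff T 0) N y = 0.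
    rewrite -z0 -yz; move: y {yz}.
    apply: (@tensor_linear_ext _ _ _ (tensor_map (free_diff T 0) N)
      (tensor_map (Omega_incl T) N \o tensor_map (augmentation (Omega T)) N)) => m n /=.
    by rewrite !tensor_map_tens.
  have yk : y \in kernel (tensor_map (free_diff T 0) N) by rewrite kernelE dy.
  have /quo_pi_eq0 := Tor0 (quo_pi _ (Submod yk)).
  rewrite -[_ \in _]/(y \in Defs.image _) => /mem_imageP[x xy].
  rewrite -yz -xy; move: x {xy}.
  apply: (@tensor_linear_ext _ _ _
    (tensor_map (augmentation (Omega T)) N \o tensor_map (free_diff T 1) N) \0) => m n /=.
  rewrite !tensor_map_tens /=.
  rewrite [augmentation _ _](ses_comp0 (ses_Omega (Omega T))).
  by have := @tens_suml _ _ _ [::] (fun _ : nat => (0 : Omega T)) n; rewrite !big_nil.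
have [al [al' [alP al'P]]] := ses_map_projective so sie projP.
have [be [be' [beP be'P]]] := ses_map_projective sie so (@free_on_projective _ T).
(* The homotopy: on K the identity is be' al' + h i, and both summands kill z after tensoring. *)
have [|h hP] := ses_lift (g := idfun \- (be \o al) : {linear P -> P}) sie.
  by move=> x; rewrite /= linearB beP alP subrr.
apply: linear_inj0 => z iz.
have alz : tensor_map al' N z = 0.
  apply: omN0; transitivity (tensor_map al N (tensor_map i N z)); last by rewrite iz linear0.
  move: z {iz}; apply: (@tensor_linear_ext _ _ _
    (tensor_map (Omega_incl T) N \o tensor_map al' N)
    (tensor_map al N \o tensor_map i N)) => m n /=.
  by rewrite !tensor_map_tens al'P.
have zE : z = tensor_map be' N (tensor_map al' N z) + tensor_map h N (tensor_map i N z).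
  move: z {iz alz}; apply: (@tensor_linear_ext _ _ _ idfun
    ((tensor_map be' N \o tensor_map al' N) \+ (tensor_map h N \o tensor_map i N))) => m n /=.
  rewrite !tensor_map_tens.
  have := @tens_suml _ _ _ [:: be' (al' m); h (i m)] id n.
  rewrite !big_cons !big_nil !addr0 => <-; congr tens; apply: ii.
  by rewrite linearD be'P al'P hP /= addrC subrK.
by rewrite zE alz iz !linear0 addr0.
Qed.

End TensorMaps.

(** * Projective covers, the transpose and lambda M *)

Section ProjectiveCovers.
Variables (R : comNzRingType).
Implicit Types L M N P Q T U V W : lmodType R.

Lemma projective_cover_surj P M Q (p : {linear P -> M}) (a : {linear Q -> P}) :
  projective_cover p -> surjective (p \o a) -> surjective a.
Proof.
move=> [_ _ sup] pas x; apply/mem_imageP; apply: sup => y.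
have [z zy] := pas (p y).
exists (y - a z), (a z); split; last by rewrite subrK.
  by rewrite kernelE linearB [p (a z)]zy subrr.
by apply/mem_imageP; exists z.
Qed.

Lemma projective_cover_iso P M P' M' (p : {linear P -> M}) (p' : {linear P' -> M'})
    (k : {linear M -> M'}) (a : {linear P -> P'}) :
  projective_cover p -> projective_cover p' -> injective k -> surjective k ->
  (forall x, p' (a x) = k (p x)) -> injective a /\ surjective a.
Proof.
move=> cp cp' ki ks ap; have [projP ps sup] := cp; have [projP' p's _] := cp'.
have as_ : surjective a.
  apply: projective_cover_surj cp' _ => m'.
  have [m <-] := ks m'; have [x <-] := ps m; exists x.
  by rewrite /= ap.
split=> //; have [s sP] := projective_lift (@idfun P' : {linear P' -> P'}) projP' as_.
have ss : surjective s.
  apply: projective_cover_surj cp _ => m.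
  have [x xm] := ps m; exists (a x) => /=.
  by apply: ki; rewrite -ap sP /= ap xm.
by apply: linear_inj0 => x; have [y <-] := ss x => /=; rewrite sP /= => ->; rewrite linear0.
Qed.

Lemma projective_cover_fin_gen P M (p : {linear P -> M}) :
  projective_cover p -> fin_gen M -> fin_gen P.
Proof.
move=> cp /fin_free_cover[F [phi [dF phis]]]; have [_ ps _] := cp.
have [s sP] := projective_lift phi (dual_basis_projective dF) ps.
apply: (fin_gen_surj (e := s)); last exact: dual_basis_fin_gen.
by apply: projective_cover_surj cp _ => m; have [x <-] := phis m; exists x; rewrite /= sP.
Qed.

Lemma minimal_presentation_kernel (P1 P0 M : lmodType R) (f : {linear P1 -> P0})
    (p : {linear P0 -> M}) v :
  minimal_presentation f p -> p v = 0 <-> exists u, f u = v.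
Proof.
move=> [[_ ps _] [q [_ qs _] qf]].
split=> [pv|[u <-]]; last by rewrite -qf; exact: submod_kernelP.
have kv : v \in kernel p by rewrite kernelE pv.
by have [u uP] := qs (Submod kv); exists u; rewrite -qf uP.
Qed.

Lemma minimal_presentation_fin_gen (P1 P0 M : lmodType R) (f : {linear P1 -> P0})
    (p : {linear P0 -> M}) :
  noetherian R -> fin_gen M -> minimal_presentation f p -> fin_gen P0 /\ fin_gen P1.
Proof.
move=> nR fM [cp [q cq _]]; have f0 := projective_cover_fin_gen cp fM.
split=> //; apply: (projective_cover_fin_gen cq).
by apply: (noetherian_fin_gen nR f0 (i := ker_incl p)); exact: val_inj.
Qed.

(* Tr M does not depend on the minimal presentation of M. *)
Lemma transpose_presentation M T (P1 P0 : lmodType R) (f : {linear P1 -> P0})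
    (p : {linear P0 -> M}) :
  is_transpose M T -> minimal_presentation f p ->
  exists pi : {linear {linear P1 -> R^o} -> T}, surjective pi /\
    forall phi, pi phi = 0 <-> exists psi : {linear P0 -> R^o}, forall u, phi u = psi (f u).
Proof.
move=> [P1' [P0' [f' [p' [mp' isoT]]]]] mp.
have [[cp [q cq qf]] [cp' [q' cq' q'f]]] := (mp, mp').
have [projP0 ps _] := cp; have [projP0' p's _] := cp'.
have [projP1 qs _] := cq; have [projP1' q's _] := cq'.
have [a0 a0P] := projective_lift p' projP0' ps.
have [a0i a0s] : injective a0 /\ surjective a0.
  by apply: (projective_cover_iso (k := idfun) cp' cp _ _ a0P) => // x; exists x.
have [|k kP] := ses_lift (g := a0 \o ker_incl p') (ses_kernel ps).
  by move=> x; rewrite /= a0P; exact: submod_kernelP.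
have [ki ks] : injective k /\ surjective k.
  split=> [x y kxy|y].
    by apply: val_inj; apply: a0i; have := kP y; rewrite -kxy kP.
  have [x xy] := a0s (ker_incl p y).
  have kx : x \in kernel p' by rewrite kernelE -a0P xy; apply/eqP; exact: submod_kernelP.
  by exists (Submod kx); apply: val_inj; rewrite -xy; exact: kP.
have [a1 a1P] := projective_lift (k \o q') projP1' qs.
have [a1i a1s] := projective_cover_iso cq' cq ki ks a1P.
have fa u : f (a1 u) = a0 (f' u).
  by rewrite -qf a1P /= -[LHS]/(ker_incl p (k (q' u))) kP /= q'f.
have [b a1K bK] := linear_inverse a1i a1s.
have [g /bij_inj_surj[gi gs]] := isomorphic_sym isoT.
pose qp : {linear {linear P1' -> R^o} -> coker (precomp f' R^o)} := quo_pi _.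
have qpP phi : qp phi = 0 <-> exists psi : {linear P0' -> R^o}, forall u, phi u = psi (f' u).
  rewrite quo_pi_eq0 mem_imageP; split=> [[psi <-]|[psi psiP]]; exists psi => //.
  by apply: linear_ext => u; rewrite psiP.
exists (g \o (qp \o precomp a1 R^o)); split=> [t|phi].
  have [x <-] := gs t; exists (repr x \o b : {linear P1 -> R^o}) => /=.
  congr (g _); rewrite -[RHS]quo_reprK; congr (quo_pi _ _).
  by apply: linear_ext => u /=; rewrite a1K.
have -> : (g \o (qp \o precomp a1 R^o)) phi = 0 <-> qp (precomp a1 R^o phi) = 0.
  by split=> [gq|/= ->]; [apply: gi; rewrite linear0 | rewrite linear0].
rewrite qpP; split=> [[psi psiP]|[psi psiP]]; last first.
  by exists (psi \o a0 : {linear P0' -> R^o}) => u /=; rewrite psiP fa.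
have [c a0K cK] := linear_inverse a0i a0s.
exists (psi \o c : {linear P0 -> R^o}) => u; have [w <-] := a1s u.
by rewrite [LHS](psiP w) /= fa a0K.
Qed.

(* P1^* -> Tr M is itself a projective cover: a projection of P1^* onto a
   summand inside the image of P0^* dualizes to an idempotent of P0 with image
   in ker(P0 -> M), which is superfluous. *)
Lemma dual_presentation_cover M T Q (P1 P0 : lmodType R) (f : {linear P1 -> P0})
    (p : {linear P0 -> M}) (pi : {linear {linear P1 -> R^o} -> T})
    (q : {linear Q -> T}) (a : {linear {linear P1 -> R^o} -> Q}) :
  minimal_presentation f p -> fin_gen P1 -> surjective pi ->
  (forall phi, pi phi = 0 <->
     exists psi : {linear P0 -> R^o}, forall u, phi u = psi (f u)) ->
  projective_cover q -> (forall phi, q (a phi) = pi phi) ->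
  injective a /\ surjective a.
Proof.
move=> mp fP1 pis piP cq qa; have [[_ _ sup] [_ [projP1 _ _] _]] := mp.
have [projQ qs _] := cq.
have as_ : surjective a.
  by apply: projective_cover_surj cq _ => t; have [phi <-] := pis t; exists phi; rewrite /= qa.
have dP1 := projective_dual_basis projP1 fP1.
have [m [x [phi P_]]] := dP1.
have projP1d := dual_basis_projective (dual_dual_basis dP1).
have [s sP] := projective_lift (@idfun Q : {linear Q -> Q}) projQ as_.
pose e : {linear {linear P1 -> R^o} -> {linear P1 -> R^o}} := idfun \- (s \o a).
have eE ph : e ph = ph - s (a ph) by [].
have ae ph : a (e ph) = 0 by rewrite eE linearB sP subrr.
have ee ph : e (e ph) = e ph by rewrite [LHS]eE ae linear0 subr0.
have [|e' e'P] := ses_lift (g := e) (ses_kernel pis).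
  by move=> ph; rewrite -qa ae linear0.
have [|l lP] := ses_lift (g := precomp f R^o) (ses_kernel pis).
  by move=> psi; apply/piP; exists psi.
have ls : surjective l.
  move=> k; have /piP[psi psiP] := submod_kernelP k.
  exists psi; apply: val_inj; rewrite [LHS](lP psi).
  by apply: linear_ext => u; rewrite psiP.
(* The idempotent [e] has its image in the kernel of [pi], that is, among the functionals coming
   from P0, so it lifts there. Below, [b1] is the transpose of [b] and [e1] that of [e]. *)
have [b bP] := projective_lift e' projP1d ls.
have be ph u : b ph (f u) = e ph u.
  by rewrite -[LHS]/(precomp f R^o (b ph) u) -lP bP e'P.
have [c cP] := choice (fun i => functional_linear (b (phi i)) (x i)).
have [b1 b1P] := sum_linear c.
have phb1 (ph : {linear P1 -> R^o}) v : ph (b1 v) = b ph v.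
  have phE : ph = \sum_i (ph (x i) : R) *: phi i.
    apply: linear_ext => u; rewrite hom_sumE (dual_basis_hom_expand P_).
    by apply: eq_bigr => i _; exact: mulrC.
  rewrite b1P linear_sum [in RHS]phE linear_sum hom_sumE.
  by apply: eq_bigr => i _; rewrite cP !linearZ_LR /=; exact: mulrC.
have sep u v : (forall ph : {linear P1 -> R^o}, ph u = ph v) -> u = v.
  by move=> uv; rewrite [u]P_ [v]P_; apply: eq_bigr => i _; rewrite uv.
pose e1 u := b1 (f u).
have phe1 (ph : {linear P1 -> R^o}) u : ph (e1 u) = e ph u by rewrite phb1 be.
have e1e1 u : e1 (e1 u) = e1 u by apply: sep => ph; rewrite !phe1 ee.
(* The composite f b1 need not be idempotent, but its square f e1 b1 is, because [e1] is. *)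
pose g : {linear P0 -> P0} := f \o (b1 \o (f \o b1)).
have gE v : g v = f (e1 (b1 v)) by [].
have g0 v : g v = 0.
  apply/eqP; rewrite -kernelE; apply: sup => w.
  exists (g w), (w - g w); split; last by rewrite addrC subrK.
    by rewrite kernelE; apply/eqP/(minimal_presentation_kernel _ mp); exists (e1 (b1 w)).
  by rewrite kernelE linearB !gE -/(e1 _) !e1e1 subrr.
have e10 u : e1 u = 0.
  by rewrite -e1e1 -[e1 u]e1e1 -[LHS]/(b1 (g (f u))) g0 linear0.
split=> //; apply: linear_inj0 => ph aph0; apply: linear_ext => u.
have : e ph = ph by rewrite eE aph0 linear0 subr0.
by move=> <-; rewrite -phe1 e10 linear0.
Qed.

(** The projective cover of Tr M being the dual of P1, its kernel lambda M is the image of the dual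
    of P0. *)
Lemma lambda_embedding M L :
  noetherian R -> fin_gen M -> is_lambda M L ->
  exists (P1 P0 : lmodType R) (f : {linear P1 -> P0}) (p : {linear P0 -> M})
      (j : {linear L -> {linear P1 -> R^o}}),
    [/\ minimal_presentation f p, injective j
      & forall phi, (exists l, j l = phi) <->
          exists psi : {linear P0 -> R^o}, forall u, phi u = psi (f u)].
Proof.
move=> nR fM [T [TM [Q [q [cq isoL]]]]].
have [P1 [P0 [f [p [mp _]]]]] := TM.
have [_ fP1] := minimal_presentation_fin_gen nR fM mp.
have [pi [pis piP]] := transpose_presentation TM mp.
have [_ [_ [projP1 _ _] _]] := mp; have [projQ qs _] := cq.
have projP1d := dual_basis_projective (dual_dual_basis (projective_dual_basis projP1 fP1)).
have [a aP] := projective_lift pi projP1d qs.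
have [ai as_] := dual_presentation_cover mp fP1 pis piP cq aP.
have [b aK bK] := linear_inverse ai as_.
have [g /bij_inj_surj[gi gs]] := isoL.
exists P1, P0, f, p, (b \o (ker_incl q \o g)); split=> //.
  move=> x y /(can_inj bK) xy; apply: gi; exact: val_inj.
move=> phi; rewrite -piP -aP; split=> [[l <-]|qa].
  by rewrite bK; exact: submod_kernelP.
have ka : a phi \in kernel q by rewrite kernelE qa.
have [l lP] := gs (Submod ka); exists l; rewrite /= lP /=.
exact: aK.
Qed.

End ProjectiveCovers.

(** * Presenting the tensor product of lambda M with C, and the equivalence *)

Section Linkage.
Variables (R : comNzRingType) (C : lmodType R).
Implicit Types L M N P Q T U V W : lmodType R.

Lemma lambda_tensor_presentation M L T (P1 P0 : lmodType R)
    (f : {linear P1 -> P0}) (p : {linear P0 -> M}) (j : {linear L -> {linear P1 -> R^o}})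
    (pi : {linear {linear P1 -> R^o} -> T}) :
  minimal_presentation f p -> fin_gen P0 -> fin_gen P1 -> injective j ->
  (forall phi, (exists l, j l = phi) <->
     exists psi : {linear P0 -> R^o}, forall u, phi u = psi (f u)) ->
  surjective pi ->
  (forall phi, pi phi = 0 <->
     exists psi : {linear P0 -> R^o}, forall u, phi u = psi (f u)) ->
  is_zero (Tor 1 T C) ->
  exists e : {linear {linear P0 -> C} -> tensor L C}, surjective e /\
    forall h, e h = 0 <-> exists g : {linear M -> C}, forall v, h v = g (p v).
Proof.
move=> mp fP0 fP1 ji jP pis piP Tor0.
have [[projP0 ps _] [_ [projP1 _ _] _]] := mp.
have dP1 := projective_dual_basis projP1 fP1.
have sj : ses j pi by split=> // phi; rewrite piP -jP.
have inj := Tor1_tensor_injective sj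
  (dual_basis_projective (dual_dual_basis dP1)) Tor0.
have [m [x [phi P1_]]] := dP1.
have [n [y [psi P0_]]] := projective_dual_basis projP0 fP0.
have l_ex i : exists l : L, forall u, j l u = psi i (f u).
  have [|l lE] := (jP (psi i \o f : {linear P1 -> R^o})).2; first by exists (psi i).
  by exists l => u; rewrite lE.
have [l lP] := choice l_ex.
(* In coordinates, the identification of Hom(P0, C) with the tensor product of the dual of P0 and C,
   followed by the surjection from that dual to L. *)
have lin : linear (fun h : {linear P0 -> C} => \sum_i tens (l i) (h (y i))).
  move=> a h g; rewrite scaler_sumr -big_split /=; apply: eq_bigr => i _.
  rewrite -tensZr.
  have := @tens_sumr _ _ _ _ [:: a *: h (y i); g (y i)] (l i) id.
  by rewrite !big_cons !big_nil !addr0.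
exists (mk_linear lin); split.
  apply: tensor_ind => [|a _ _ [h <-] [g <-]|u c].
  - by exists 0; rewrite linear0.
  - by exists (a *: h + g); rewrite linearP.
  have [ps' ps'P] : exists ps' : {linear P0 -> R^o}, forall w, j u w = ps' (f w).
    by apply/jP; exists u.
  have [h hP] := functional_linear ps' c; exists h => /=.
  transitivity (tens (\sum_i (ps' (y i) : R) *: l i) c).
    rewrite tens_suml; apply: eq_bigr => i _.
    by rewrite hP tensZr tensZl.
  congr tens; apply: ji; apply: linear_ext => w.
  rewrite linear_sum hom_sumE ps'P (dual_basis_hom_expand P0_).
  by apply: eq_bigr => i _; rewrite linearZ_LR /= lP; exact: mulrC.
have jeE h : tensor_map j C (mk_linear lin h) = \sum_k tens (phi k) (h (f (x k))).
  rewrite linear_sum.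
  transitivity (\sum_i \sum_k tens (phi k) ((psi i (f (x k)) : R) *: h (y i))).
    apply: eq_bigr => i _; rewrite tensor_map_tens.
    have -> : j (l i) = \sum_k (psi i (f (x k)) : R) *: phi k.
      apply: linear_ext => u; rewrite hom_sumE lP {1}[u]P1_ !linear_sum.
      by apply: eq_bigr => k _; rewrite !linearZ_LR /=; exact: mulrC.
    by rewrite tens_suml; apply: eq_bigr => k _; rewrite tensZr tensZl.
  rewrite exchange_big; apply: eq_bigr => k _.
  by rewrite -tens_sumr (dual_basis_hom_expand P0_ h).
move=> h; split=> [eh0|[g gP]]; last first.
  apply: inj; rewrite linear0 jeE; apply: big1 => k _.
  rewrite gP (_ : p (f (x k)) = 0).
    by have := @tens_sumr _ _ _ nat [::] (phi k) (fun=> 0 : C); rewrite !big_nil linear0.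
  by apply/(minimal_presentation_kernel _ mp); exists (x k).
have hf u : h (f u) = 0.
  (* Evaluation of L at u, extended to the tensor product, recovers h (f u) from e h. *)
  have [t tP] := functional_tensor_linear C (biduality R^o u \o j : {linear L -> R^o}).
  have := congr1 t eh0; rewrite linear0 /= linear_sum => <-.
  rewrite (dual_basis_hom_expand P0_ h); apply: eq_bigr => i _.
  by rewrite tP /= -[biduality _ _ _]/(j (l i) u) lP.
have [|g gP] := ses_factor (g := h) (ses_kernel ps); last by exists g => v; rewrite gP.
move=> k; have [u uk] := (minimal_presentation_kernel (ker_incl p k) mp).1 (submod_kernelP k).
by rewrite -uk hf.
Qed.

(** In a free module containing P as a summand, a nonzero coordinate is detected by multiplying it
    into the faithful module C. *)
Lemma projective_torsionless P : semidualizing C -> projective P -> torsionless C P.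
Proof.
move=> sC projP x x0.
have [s sP] := projective_lift (@idfun P : {linear P -> P}) projP (@augmentation_surj R P).
have -> : x = augmentation P (s x) by rewrite sP.
rewrite (_ : s x = 0) ?linear0 //; apply/eqP/freeg_eqP => k; rewrite coeff0.
have lin : linear (coeff k : free_on P -> R^o).
  by move=> a y z; rewrite coeffD coeffZ.
apply: (C_faithful sC) => c.
have [f fP] := functional_linear (mk_linear lin) c.
by have := x0 (f \o s : {linear P -> C}); rewrite /= fP.
Qed.

Lemma horizontally_linked_torsionless M :
  semidualizing C -> horizontally_linked M -> torsionless C M.
Proof.
move=> sC [L [N [_ [T [_ [Q [q [[projQ _ _] isoN]]]]] isoM]]].
have [g /bij_inj_surj[gi _]] := isoN; have [h /bij_inj_surj[hi _]] := isoM.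
move=> x x0; apply: hi; apply: gi; apply: val_inj; rewrite !linear0.
apply: (projective_torsionless sC projQ) => k.
exact: (x0 (k \o (ker_incl q \o (g \o h)) : {linear M -> C})).
Qed.

End Linkage.

Theorem corollary4p8 (R : comNzRingType) (C M T L : lmodType R) (n t : nat)
    (R_noetherian : noetherian R) (R_semiperfect : semiperfect R)
    (C_semidualizing : semidualizing C)
    (M_fin_gen : fin_gen M) (M_linked : horizontally_linked M)
    (T_transpose : is_transpose M T) (L_lambda : is_lambda M L)
    (Tor_vanish : is_zero (Tor 1 T C))
    (n_gt0 : (0 < n)%N) (t_gt0 : (0 < t)%N) :
  [/\ reduced_G_perfect C M, G_dim C M = Some n,
      G_perfect C (Ext n M C) & G_dim C (Ext n M C) = Some (n + t)%N]
  <->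
  [/\ reduced_G_perfect C (tensor L C), G_dim C (tensor L C) = Some t,
      G_perfect C (Ext t (tensor L C) C)
    & G_dim C (Ext t (tensor L C) C) = Some (n + t)%N].
Proof.
have [P1 [P0 [f [p [j [mp ji jP]]]]]] := lambda_embedding R_noetherian M_fin_gen L_lambda.
have [fP0 fP1] := minimal_presentation_fin_gen R_noetherian M_fin_gen mp.
have [pi [pis piP]] := transpose_presentation T_transpose mp.
have [e [es eP]] := lambda_tensor_presentation mp fP0 fP1 ji jP pis piP Tor_vanish.
have [[projP0 ps _] _] := mp.
have TP0 := totally_reflexive_projective C_semidualizing projP0 fP0.
split; first exact: linked_reduced_perfect TP0 ps es eP n_gt0 t_gt0.
have /totally_reflexiveP[_ [tP0 eP0] _ _] := TP0.
(* The converse exchanges the roles: [q] is the isomorphism from the bidual of P0 to P0 followed by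
   [p], and M becomes the cokernel attached to [e]. *)
have [||y|q qP] := @linear_choice R {linear {linear P0 -> C} -> C} M
  (fun Psi x => exists2 v, forall h, Psi h = h v & p v = x).
- by move=> Psi; have [v vP] := eP0 Psi; exists (p v), v.
- move=> a Psi Phi _ _ [v vP <-] [w wP <-]; exists (a *: v + w); last by rewrite linearP.
  by move=> h; rewrite /= vP wP linearP.
- by move=> [v vP <-]; rewrite (tP0 v) ?linear0 // => h; rewrite -vP.
have qE v : q (biduality C v) = p v.
  have [w wP <-] := qP (biduality C v); congr (p _).
  apply/eqP; rewrite -subr_eq0; apply/eqP/tP0 => h.
  by rewrite linearB -wP subrr.
rewrite addnC.
apply: (linked_reduced_perfect R_noetherian C_semidualizing (e := e) (q := q)) => //.
- exact: totally_reflexive_dual.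
- by move=> x; have [v <-] := ps x; exists (biduality C v).
move=> Psi; have [v vP] := eP0 Psi.
have -> : Psi = biduality C v by apply: linear_ext => h; rewrite vP.
rewrite qE; split=> [pv|[g gP]].
  have [|g gP] := ses_factor (g := biduality C v) (ses_kernel es).
    move=> k; have /eP[g gE] := submod_kernelP k.
    by rewrite -[LHS]/(ker_incl e k v) gE pv linear0.
  by exists g => h; rewrite gP.
(* Here evaluation at v factors through [e], which kills every functional h p, so h (p v) = 0 for
   all h. *)
apply: (horizontally_linked_torsionless C_semidualizing M_linked) => h.
rewrite [LHS](gP (h \o p : {linear P0 -> C})).
by rewrite (eP _).2 ?linear0 //; exists h.
Qed.
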